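(* Let $\pi(y)$ denote the number of ordinary primes $\le y$. For a nonnegative nondecreasing function $\mathcal{Q}$ on $]1,\infty[$, let $\mathcal{N}_{\mathcal{Q}}$ denote the nondecreasing function on $[1,\infty[$ with $\mathcal{N}_{\mathcal{Q}}(1)=1$ determined by $$\int x^{-s}\,d\mathcal{N}_{\mathcal{Q}}(x)=\exp\int\log\big(1-y^{-s}\big)^{-1}\,d\mathcal{Q}(y)\qquad(\Re s>1).$$ Consider the two operations: (Rule 1) replace $\mathcal{Q}$ by any nondecreasing function $\mathcal{Q}'$ with $\mathcal{Q}'(y)=\mathcal{Q}(y)+O(1)$ as $y\to\infty$; (Rule 2) replace $\mathcal{Q}$ by any nondecreasing function $\mathcal{Q}'$ with $|\mathcal{Q}'(y)-\pi(y)|\le|\mathcal{Q}(y)-\pi(y)|$ for all $y>1$. Let $\mathcal{P}$ be a nonnegative nondecreasing function on $]1,\infty[$ with $\mathcal{P}(y)=o(y)$ as $y\to\infty$, and suppose that for every function $\mathcal{P}'$ obtained from $\mathcal{P}$ by applying Rules 1 and 2, the function $\mathcal{N}_{\mathcal{P}'}$ has a density, i.e. $\lim_{x\to\infty}\mathcal{N}_{\mathcal{P}'}(x)/x$ exists and is finite and nonzero. Then $$\int_1^\infty\frac{|\mathcal{P}(y)-\pi(y)|}{y^2}\,dy<\infty.$$ Equivalently: among the conditions on $\mathcal{P}$ which are preserved under Rules 1 and 2 and which imply that $\mathcal{N}_{\mathcal{P}}$ has a density, the condition $\int_1^\infty|\mathcal{P}(y)-\pi(y)|y^{-2}\,dy<\infty$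 is optimal: every such condition implies it.
   Context: Beurling's framework: $\mathcal{P}$ plays the role of the counting function of a set (or multiset) of generalized primes in $]1,\infty[$, and $\mathcal{N}_{\mathcal{P}}$ the counting function of the generalized integers it generates multiplicatively (with multiplicity); for general nondecreasing $\mathcal{P}$ the relation displayed defines $\mathcal{N}_{\mathcal{P}}$. *)

(* Defs.v *)
From HB Require Import structures.
From mathcomp Require Import all_boot all_order all_algebra.
From mathcomp Require Import all_classical all_reals all_analysis.
From mathcomp Require Import complex.
Set Implicit Arguments.
Unset Strict Implicit.
Unset Printing Implicit Defensive.
Import Order.TTheory GRing.Theory Num.Theory.
Import numFieldNormedType.Exports.
Local Open Scope classical_set_scope.
Local Open Scope ring_scope.
Local Open Scope complex_scope.

(* Functions on ]1, +oo[ are represented by total functions R -> R of which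
   only the values on ]1, +oo[ are ever used. *)

Section Beurling.
Variable R : realType.
Implicit Types (Q P : R -> R) (s z w : R[i]) (x y : R).

Definition primepi y : R :=
  (\sum_(p < (Num.truncn y).+1 | prime p) 1)%N%:R.

Definition cexp z : R[i] :=
  let: a +i* b := z in (expR a * cos b) +i* (expR a * sin b).

(* Principal logarithm, on the half-plane Re w > 0 only. It is applied to
   w = (1 - y^-s)^-1, which lies there since |y^-s| < 1. *)
Definition clog w : R[i] :=
  let: a +i* b := w in ln (Normc.normc w) +i* atan (b / a).

Definition cpow x s : R[i] := cexp (s * (ln x)%:C).

Definition stieltjes_cintegrable (F : cumulative R R) (D : set R)
    (f : R -> R[i]) : Prop :=
  (lebesgue_stieltjes_measure F).-integrable D (fun x => (complex.Re (f x))%:E)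
  /\
  (lebesgue_stieltjes_measure F).-integrable D (fun x => (complex.Im (f x))%:E).

Definition stieltjes_cintegral (F : cumulative R R) (D : set R)
    (f : R -> R[i]) : R[i] :=
  (Rintegral (lebesgue_stieltjes_measure F) D (fun x => complex.Re (f x)))
  +i* (Rintegral (lebesgue_stieltjes_measure F) D (fun x => complex.Im (f x))).

Definition nonneg_nondecreasing Q : Prop :=
  (forall y, 1 < y -> 0 <= Q y) /\
  (forall x y, 1 < x -> x <= y -> Q x <= Q y).

(* Q need not be right-continuous: dQ on ]1, +oo[ is the Stieltjes measure of
   the right-continuous regularization y |-> Q(y+). *)
Definition right_regularization Q (F : cumulative R R) : Prop :=
  forall y, 1 < y -> Q z @[z --> y^'+] --> F y.

(* [is_calN Q N]: N is the function $\mathcal{N}_Q$, normalized to be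
   right-continuous and extended by 0 on ]-oo, 1[, so that dN has mass
   N(1) = 1 at the point 1. Both integrals are required to converge
   absolutely. Such an N need not exist: if dQ has too much mass near 1, the
   integral of log (1 - y^-s)^-1 diverges there. *)
Definition is_calN Q (N : cumulative R R) : Prop :=
  [/\ forall x, x < 1 -> N x = 0,
      N 1 = 1 &
      exists F : cumulative R R, right_regularization Q F /\
        forall s, 1 < complex.Re s ->
        [/\ stieltjes_cintegrable N `[1, +oo[ (fun x => cpow x (- s)),
            stieltjes_cintegrable F `]1, +oo[
              (fun y => clog (1 - cpow y (- s))^-1) &
            stieltjes_cintegral N `[1, +oo[ (fun x => cpow x (- s)) =
            cexp (stieltjes_cintegral F `]1, +oo[
              (fun y => clog (1 - cpow y (- s))^-1))]].

(* The condition bears on the Q for which $\mathcal{N}_Q$ is defined. Demanding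
   existence of N for every function obtained by the two rules would be
   unsatisfiable, since they can always create the divergence at 1 described
   above. *)
Definition has_density Q : Prop :=
  forall N : cumulative R R, is_calN Q N ->
  exists2 c : R, c != 0 & N x / x @[x --> +oo] --> c.

Definition rule1 Q Q' : Prop :=
  exists M : R, \forall y \near +oo, `|Q' y - Q y| <= M.

Definition rule2 Q Q' : Prop :=
  forall y, 1 < y -> `|Q' y - primepi y| <= `|Q y - primepi y|.

Inductive obtained P : (R -> R) -> Prop :=
| obtained_refl : obtained P P
| obtained_rule1 Q Q' : obtained P Q -> nonneg_nondecreasing Q' ->
    rule1 Q Q' -> obtained P Q'
| obtained_rule2 Q Q' : obtained P Q -> nonneg_nondecreasing Q' ->
    rule2 Q Q' -> obtained P Q'.

Definition admissible Q : Prop :=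
  nonneg_nondecreasing Q /\ Q y / y @[y --> +oo] --> 0.

Definition preserved (C : (R -> R) -> Prop) : Prop :=
  forall Q Q', admissible Q -> admissible Q' ->
    rule1 Q Q' \/ rule2 Q Q' -> C Q -> C Q'.

Definition close_to_primepi Q : Prop :=
  (\int[lebesgue_measure]_(y in `]1%R, +oo[) (`|Q y - primepi y| / y ^+ 2)%:E
    < +oo)%E.

End Beurling.

(* Main.v *)
(* For y in [n, n+1[ round P, from P towards pi, to functions of n with natural
   values: one lies between pi and max(P, pi), the other between min(P, pi) and
   pi.  Both are obtained from P by Rule 2, and both count generalized primes
   which are ordinary integers >= 2 with multiplicities q(n) - q(n-1), so that
   the generalized integers they generate have a Dirichlet series
   D_q(s) = \prod_(n >= 2) (1 - n^-s)^-(q(n) - q(n-1)) with natural coefficients;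
   q = pi gives the zeta function.

   A density for N_q makes N_q(n) comparable to n, so by Abel summation D_q is
   comparable to zeta on ]1, +oo[, uniformly up to s = 1.  The logarithm of
   D_q / zeta is \sum_n (q(n) - pi(n)) (l_n(s) - l_(n+1)(s)), where
   l_n(s) = - log (1 - n^-s).  Its terms all have the same sign, hence its
   boundedness passes to s = 1, where l_n - l_(n+1) >= 1/n^2.  The two roundings
   thus give \sum_n |q(n) - pi(n)| / n^2 < +oo, and together they control
   |P - pi|. *)
Require Import Defs.
From mathcomp Require Import all_boot all_order all_algebra.
From mathcomp Require Import all_classical all_reals all_analysis.
From HB Require Import structures.
From mathcomp Require Import measurable_realfun complex.
From mathcomp Require Import zify ring lra.
Set Implicit Arguments.
Unset Strict Implicit.
Unset Printing Implicit Defensive.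
Import Order.TTheory GRing.Theory Num.Theory.
Import numFieldNormedType.Exports.

(** [has_density] speaks of every N satisfying [is_calN], so it yields nothing until some N is
    exhibited. This is why the roundings take natural values and jump only at integers: the
    multiplicities are natural numbers and N is an explicit step function with coefficients
    [beurling_coef], where a general P would require the exponential of a Stieltjes measure. The
    price is that [is_calN] must be checked for all complex s, although the later comparison lives
    on the real axis. Two roundings are needed because P - pi may change sign, and a bounded sum of
    terms of varying sign says nothing about absolute values. The upper rounding uses only the upper
    bound on its N, the lower rounding only the lower bound, each against zeta, whose coefficient
    sums are exactly n. The roundings must remain o(y), both to be admissible and to make their
    Dirichlet series converge for s > 1; the Chebyshev argument supplies pi(y) = o(y) for this. *)

(** * Arithmetic of generalized integers *)

(* Coefficients of the product of the Dirichlet series of [a] with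
   (1 - g^-s)^-1 = \sum_j (g^j)^-s. *)
Definition geom_conv (g : nat) (a : nat -> nat) (n : nat) : nat :=
  \sum_(j < n.+1 | g ^ j %| n) a (n %/ g ^ j).

Lemma geom_conv0 g a : a 0 = 0 -> geom_conv g a 0 = 0.
Proof. by move=> a0; rewrite /geom_conv big1// => j _; rewrite div0n. Qed.

(** The identity (1 - g^-s) B(s) = A(s) read on coefficients. The index 0 has to carry no mass
    because every power of g divides it. *)
Lemma geom_convE g a n : 1 < g -> a 0 = 0 ->
  geom_conv g a n = a n + (if g %| n then geom_conv g a (n %/ g) else 0).
Proof.
move=> g1 a0; have [->|n0] := posnP n; first by rewrite div0n dvdn0 !geom_conv0 ?a0.
have g0 : 0 < g by lia.
rewrite /geom_conv big_mkcond big_ord_recl expn0 dvd1n divn1; congr addn.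
case: ifPn => [/dvdnP[k nE]|ndvd]; last first.
  rewrite big1// => i _; case: ifPn => // h; case/negP: ndvd.
  by apply: dvdn_trans h; rewrite /= /bump /= add1n expnS dvdn_mulr.
have kE : n %/ g = k by rewrite nE mulnK.
have k0 : 0 < k by move: n0; rewrite nE; case: (k).
have kn : k < n by rewrite nE ltn_Pmulr.
rewrite kE [RHS]big_mkcond/=.
rewrite -(big_mkord xpredT (fun i => if g ^ (bump 0 i) %| n
  then a (n %/ g ^ bump 0 i) else 0)).
rewrite -(big_mkord xpredT (fun i => if g ^ i %| k then a (k %/ g ^ i) else 0)).
(* The sum for n = k g has more exponents than the one for k; the extra ones satisfy i > k, and then
   g^i > k cannot divide k. *)
rewrite [LHS](big_cat_nat (n := k.+1))//= [X in _ + X]big_nat_cond.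
rewrite [X in _ + X]big1 ?addn0; last first.
  move=> i; rewrite andbT => /andP[ki _]; rewrite /bump /= add1n nE expnS.
  rewrite (mulnC k) dvdn_pmul2l//; case: ifP => // /dvdn_leq -/(_ k0).
  by rewrite leqNgt (leq_trans ki)// ltnW// ltn_expl.
apply: eq_bigr => i _; rewrite /bump /= add1n nE expnS (mulnC k).
by rewrite dvdn_pmul2l// divnMl.
Qed.

Lemma geom_conv_ge g a n : a n <= geom_conv g a n.
Proof. by rewrite /geom_conv big_mkcond big_ord_recl expn0 dvd1n divn1 leq_addr. Qed.

Lemma geom_conv_small g a n : 1 < g -> a 0 = 0 -> 0 < n < g ->
  geom_conv g a n = a n.
Proof.
move=> g1 a0 /andP[n0 ng]; rewrite geom_convE//.
case: ifP => [/dvdn_leq-/(_ n0)|_]; last exact: addn0.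
by rewrite leqNgt ng.
Qed.

(* Coefficients of \prod_(2 <= k <= K) (1 - k^-s)^-(m k). *)
Fixpoint euler_coef (m : nat -> nat) (K : nat) : nat -> nat :=
  if K is k.+1 then
    if k is 0 then fun n => (n == 1) : nat
    else iter (m K) (geom_conv K) (euler_coef m k)
  else fun n => (n == 1) : nat.

(* Generators larger than [n] do not contribute to the coefficient of n^-s. *)
Definition beurling_coef m n := euler_coef m n n.

Section Euler.
Variable m : nat -> nat.

Lemma iter_geom_conv0 g k a : a 0 = 0 -> iter k (geom_conv g) a 0 = 0.
Proof. by move=> a0; elim: k => //= k IH; rewrite geom_conv0. Qed.

Lemma euler_coefSS K : euler_coef m K.+2 =
  iter (m K.+2) (geom_conv K.+2) (euler_coef m K.+1).
Proof. by []. Qed.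

Lemma euler_coef0 K : euler_coef m K 0 = 0.
Proof. by elim: K => [|[|K] IH]//; rewrite [LHS]iter_geom_conv0. Qed.

Lemma euler_coefS K n : euler_coef m K n <= euler_coef m K.+1 n.
Proof.
case: K => [//|K]; rewrite euler_coefSS; move: (euler_coef m K.+1) => a.
by elim: (m _) => //= k IH; rewrite (leq_trans IH)// geom_conv_ge.
Qed.

Lemma euler_coef_stable K n : n <= K -> euler_coef m K.+1 n = euler_coef m K n.
Proof.
case: K => [//|K nK].
have [->|n0] := posnP n; first by rewrite !euler_coef0.
rewrite euler_coefSS; have := euler_coef0 K.+1.
move: (euler_coef m K.+1) => a a0.
by elim: (m _) => //= k IH; rewrite geom_conv_small ?iter_geom_conv0 ?n0.
Qed.

Lemma euler_coef_beurling K n : n <= K -> euler_coef m K n = beurling_coef m n.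
Proof.
move=> /subnK <-; elim: (K - n) => // k IH.
by rewrite addSn euler_coef_stable// leq_addl.
Qed.

Lemma euler_coef_le K n : euler_coef m K n <= beurling_coef m n.
Proof.
have [nK|/ltnW Kn] := leqP n K; first by rewrite euler_coef_beurling.
have h k : euler_coef m K n <= euler_coef m (k + K) n.
  by elim: k => // k IH; rewrite addSn (leq_trans IH)// euler_coefS.
by have := h (n - K); rewrite subnK.
Qed.

Lemma beurling_coef0 : beurling_coef m 0 = 0. Proof. by []. Qed.

Lemma beurling_coef1 : beurling_coef m 1 = 1. Proof. by []. Qed.

End Euler.

(** * Smooth numbers and the Euler product of zeta *)

Definition smooth K n := (0 < n) && all (fun p => p <= K) (primes n).

Lemma smoothM K a b : smooth K (a * b) = smooth K a && smooth K b.
Proof.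
rewrite /smooth muln_gt0; case: (posnP a) => //= a0; case: (posnP b) => //= b0;
  first by rewrite andbF.
apply/allP/andP => [h|[/allP ha /allP hb] p]; last first.
  by rewrite primesM// => /orP[]; [apply: ha|apply: hb].
by split; apply/allP => p pp; apply: h; rewrite primesM// pp ?orbT.
Qed.

Lemma smooth_prime K p : prime p -> smooth K p = (p <= K).
Proof. by move=> pp; rewrite /smooth primes_prime// prime_gt0//= andbT. Qed.

Lemma smoothS K n : K.+1 \notin primes n -> smooth K.+1 n = smooth K n.
Proof.
rewrite /smooth => h; congr andb; apply: eq_in_all => p pn.
by rewrite leq_eqVlt; case: eqP => // pK; rewrite -pK pn in h.
Qed.

(** Unique factorization enters here, by strong induction through [geom_convE]: with p = K + 1, a
    multiple of p is never K-smooth and is p-smooth exactly when its quotient by p is; for other n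
    the two notions agree. *)
Lemma geom_conv_smooth K n : prime K.+1 ->
  geom_conv K.+1 (fun n => smooth K n : nat) n = smooth K.+1 n.
Proof.
move=> pK; elim/ltn_ind: n => n IH; rewrite geom_convE ?prime_gt1//.
have [->|n0] := posnP n; first by rewrite geom_conv0.
case: ifPn => [/dvdnP[k nE]|nd].
  have nk : n %/ K.+1 = k by rewrite nE mulnK.
  rewrite IH ?ltn_Pdiv ?prime_gt1// nk nE !smoothM !(smooth_prime _ pK).
  by rewrite ltnn leqnn !andbT andbF.
by rewrite addn0 smoothS// mem_primes n0 pK.
Qed.

Lemma euler_coef_prime K n : euler_coef (fun k => prime k : nat) K n = smooth K n.
Proof.
have s1 n' : (n' == 1) = smooth 0 n' :> bool.
  rewrite /smooth; have [->//|n0] := posnP n'.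
  apply/eqP/allP => [-> //|h].
  have [|n1] := leqP n' 1; first by move: n0; case: n' {h} => [|[]].
  have := h (pdiv n'); rewrite mem_primes pdiv_prime// pdiv_dvd n0/=.
  by rewrite leqNgt pdiv_gt0 => /(_ isT).
elim: K n => [|[|K] IH] n; first by rewrite -s1.
  by rewrite smoothS ?mem_primes// -s1.
rewrite euler_coefSS; have [pK|pK] := boolP (prime K.+2).
  rewrite [LHS]/= -(geom_conv_smooth n pK); apply: eq_bigr => j _; exact: IH.
by rewrite [LHS]IH [in RHS]smoothS// mem_primes (negbTE pK).
Qed.

Lemma beurling_coef_prime n : 0 < n -> beurling_coef (fun k => prime k : nat) n = 1.
Proof.
move=> n0; rewrite /beurling_coef euler_coef_prime /smooth n0/=.
by rewrite (_ : all _ _)//; apply/allP => p; rewrite mem_primes => /and3P[_ _] /dvdn_leq; apply.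
Qed.

Lemma sum_dvdn_scale (A : comPzRingType) (g N : nat) (F : nat -> A) : 0 < g ->
  (\sum_(0 <= n < (g * N)%N) (if (g %| n)%N then F (n %/ g)%N else 0%R) =
   \sum_(0 <= n < N) F n :> A)%R.
Proof.
move=> g0; elim: N => [|N IH]; first by rewrite muln0 !big_geq.
rewrite mulnS (big_cat_nat (n := g * N))//= ?leq_addl// IH.
rewrite big_nat_recr//=; congr (_ + _)%R.
rewrite big_ltn ?dvdn_mulr ?mulKn//; last first. lia.
rewrite big_nat_cond big1 ?addr0// => i; rewrite andbT => /andP[i1 i2].
case: ifPn => // /dvdnP[k kE]; exfalso; subst i.
rewrite mulnC ltn_pmul2r// in i1; rewrite -mulnS mulnC ltn_pmul2l// in i2; lia.
Qed.

(** [geom_convE] summed up to g N, where the reindexing n = g k leaves no remainder. The character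
    is abstract so as to cover both [npow] and [dchar]; both take the value 1 at 0, so
    multiplicativity is available only at positive arguments. *)
Lemma geom_conv_sum (A : comPzRingType) (chi : nat -> A) (g N : nat) (a : nat -> nat) :
  1 < g -> a 0 = 0 ->
  (forall n, 0 < n -> chi (g * n) = (chi g * chi n)%R) ->
  (\sum_(0 <= n < (g * N)%N) (geom_conv g a n)%:R * chi n =
   \sum_(0 <= n < (g * N)%N) (a n)%:R * chi n +
   chi g * \sum_(0 <= n < N) (geom_conv g a n)%:R * chi n)%R.
Proof.
move=> g1 a0 chiM; rewrite big_distrr/= -[in X in (_ + X)%R](sum_dvdn_scale _ _ (ltnW g1)).
rewrite -big_split/=; apply: eq_bigr => n _; rewrite {1}geom_convE// natrD mulrDl.
congr (_ + _)%R; case: ifPn => [/dvdnP[k ->]|]; last by rewrite mul0r.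
rewrite mulnK; last by lia.
have [->|k0] := posnP k; first by rewrite geom_conv0// !mul0r mulr0.
by rewrite (mulnC k) chiM// mulrCA.
Qed.

(** * Chebyshev bound *)

Definition pin (n : nat) : nat := \sum_(p < n.+1 | prime p) 1.

Lemma pinS n : pin n.+1 = pin n + prime n.+1.
Proof. by rewrite /pin big_mkcond big_ord_recr/= -big_mkcond; case: prime. Qed.

Lemma pin0 : pin 0 = 0.
Proof. by rewrite /pin big_mkcond big_ord_recr big_ord0. Qed.

Lemma pin1 : pin 1 = 0. Proof. by rewrite pinS pin0. Qed.

Lemma pin_homo : {homo pin : m n / m <= n}.
Proof.
by apply: homo_leq => // [m n p|n]; [exact: leq_trans|rewrite pinS leq_addr].
Qed.

Lemma pin_le n : pin n <= n.
Proof. by elim: n => [|n IH]; rewrite ?pin0// pinS; case: prime; lia. Qed.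

Lemma bin_double_le n : 'C(n.*2, n) <= 4 ^ n.
Proof.
rewrite (_ : 4 ^ n = (1 + 1) ^ n.*2); last by rewrite -mul2n expnM.
rewrite expnDn (bigD1 (inord n : 'I_(n.*2).+1))//= inordK; last by lia.
by rewrite !exp1n !muln1 leq_addr.
Qed.

Lemma prime_dvd_bin_double n p : prime p -> n < p <= n.*2 -> p %| 'C(n.*2, n).
Proof.
move=> pp /andP[np pn].
have nf : ~~ (p %| n`!).
  elim: n np {pn} => [|n IH] np.
    by rewrite fact0 dvdn1; apply: contraL pp => /eqP ->.
  rewrite factS Euclid_dvdM// negb_or IH ?andbT; last by lia.
  by apply/negP => /dvdn_leq -/(_ isT); lia.
have := @bin_fact n.*2 n; rewrite -addnn leq_addr addnK => /(_ isT) E.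
have : p %| (n + n)`! by rewrite dvdn_fact// prime_gt0//= addnn.
by rewrite -E !Euclid_dvdM// (negbTE nf) !orbF.
Qed.

Lemma prod_primes_dvd n j : n <= j <= n.*2 ->
  \prod_(n.+1 <= p < j.+1 | prime p) p %| 'C(n.*2, n).
Proof.
move=> /andP[nj jn]; rewrite -(subnKC nj) in jn *; move: (j - n) jn => k {nj}.
elim: k => [|k IH] kn; first by rewrite addn0 big_geq.
rewrite addnS big_mkcond big_nat_recr/=; last by lia.
rewrite -big_mkcond/=; case: ifPn => pk; last by rewrite muln1 IH//; lia.
rewrite Gauss_dvd ?IH ?prime_dvd_bin_double//; try lia.
rewrite big_nat_cond; apply: (big_rec (fun x => coprime x (n + k).+1)) => [|i x].
  exact: coprime1n.
move=> /andP[/andP[i1 i2] pi] cx; rewrite coprimeMl cx andbT prime_coprime//.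
by rewrite dvdn_prime2//; apply/eqP => e; move: i2; rewrite e; lia.
Qed.

(** All primes in ]n, 2n] exceed n and their product divides the central binomial coefficient, which
    is at most 4^n. *)
Lemma pin_double_exp n : 0 < n -> n ^ (pin n.*2 - pin n) <= 4 ^ n.
Proof.
move=> n0; apply: leq_trans (bin_double_le n).
have := @prod_primes_dvd n n.*2; rewrite -addnn leq_addl leqnn addnn => /(_ isT).
move=> /dvdn_leq; rewrite bin_gt0 -addnn leq_addl addnn => /(_ isT); apply: leq_trans.
have h k : n ^ (pin (n + k) - pin n) <= \prod_(n.+1 <= p < (n + k).+1 | prime p) p.
  elim: k => [|k IH]; first by rewrite addn0 subnn big_geq.
  rewrite addnS pinS big_mkcond big_nat_recr/=; last by lia.
  rewrite -big_mkcond/= addnC -addnBA; last by apply: pin_homo; lia.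
  rewrite expnD mulnC leq_mul//; case: prime => //=; rewrite expn1; lia.
by have := h n; rewrite addnn.
Qed.

Lemma pin_double k n : 4 ^ k <= n -> k * (pin n.*2 - pin n) <= n.
Proof.
move=> kn; have n0 : 0 < n by apply: leq_trans kn; rewrite expn_gt0.
rewrite -(@leq_exp2l 4)//; apply: leq_trans (pin_double_exp n0).
by case: (_ - _) => [|d]; rewrite ?muln0// expnM leq_exp2r.
Qed.

(** This is pi(n) <= (4/k) n + O(1) for every k, hence pi(n) = o(n). Induction from h = n/2: once h
    >= 4^k, doubling adds at most h and a possible odd n adds k < h, so 4h grows to at most 6h <=
    4n. The constant C absorbs the n with h < 4^k. *)
Lemma pin_sublinear k : exists C, forall n, k * pin n <= 4 * n + C.
Proof.
exists (k * (4 ^ k).*2 + 4 * k)%N => n; elim/ltn_ind: n => n IH.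
set h := n./2; have nE : n = odd n + h.*2 by rewrite odd_double_half.
have [hk|hk] := ltnP h (4 ^ k).
  apply: (@leq_trans (k * n)); first by rewrite leq_mul2l pin_le orbT.
  rewrite nE; case: (odd n); nia.
have h0 : 0 < h by apply: leq_trans hk; rewrite expn_gt0.
have IHh := IH h _; have D := pin_double hk.
have M : pin h <= pin h.*2 by apply: pin_homo; lia.
have L : pin n <= pin h.*2 + 1.
  by rewrite nE; case: (odd n); rewrite ?add0n ?leq_addr// add1n pinS leq_add2l; case: prime.
have k4 : k < 4 ^ k by exact: ltn_expl.
have : h < n by lia.
have L' : k * pin n <= k * pin h.*2 + k.
  by apply: leq_trans (leq_mul (leqnn k) L) _; rewrite mulnDr muln1.
move: D; rewrite mulnBr => D /IHh IHn.
have : h.*2 <= n by rewrite /h; lia.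
move: (k * pin n) (k * pin h.*2) (k * pin h) (k * (4 ^ k).*2) D L' IHn => a b c d.
by move: hk k4; clearbody h; clear; lia.
Qed.

Local Open Scope classical_set_scope.
Local Open Scope ring_scope.
Local Open Scope complex_scope.

Local Notation normc := Normc.normc.

(** * Complex exponential and logarithm *)

Section Complex.
Variable R : realType.
Implicit Types (z w s : R[i]) (x y : R).

Lemma cexpD z w : cexp (z + w) = cexp z * cexp w.
Proof.
case: z w => [a b] [c d]; rewrite /cexp/=; simpc.
by rewrite expRD cosD sinD; congr (_ +i* _); ring.
Qed.

Lemma cexp_real x : cexp x%:C = (expR x)%:C.
Proof. by rewrite /cexp/= cos0 sin0 mulr1 mulr0. Qed.

Lemma cexp0 : cexp (0 : R[i]) = 1.
Proof. by rewrite (cexp_real 0) expR0. Qed.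

Lemma normc_cexp z : normc (cexp z) = expR (complex.Re z).
Proof.
case: z => a b /=; rewrite !exprMn -mulrDr cos2Dsin2 mulr1 sqrtr_sqr.
by rewrite ger0_norm// expR_ge0.
Qed.

Lemma ger_Re z : `|complex.Re z| <= normc z.
Proof.
by case: z => a b /=; rewrite -sqrtr_sqr ler_wsqrtr// lerDl sqr_ge0.
Qed.

Lemma ger_Im z : `|complex.Im z| <= normc z.
Proof.
by case: z => a b /=; rewrite -sqrtr_sqr ler_wsqrtr// lerDr sqr_ge0.
Qed.

Lemma normc_ge0 z : 0 <= normc z.
Proof. by case: z => a b; exact: sqrtr_ge0. Qed.

Lemma sin_atan x : sin (atan x) = x * cos (atan x).
Proof.
have := cos_atan x; set c := cos _ => cE.
have c0 : c != 0.
  by rewrite cE invr_eq0 sqrtr_eq0 -ltNge ltr_pwDl// sqr_ge0.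
by rewrite -[in RHS](atanK x) /tan -/c divfK.
Qed.

(** Polar coordinates: in the right half-plane the argument of a + ib is atan(b / a), with cosine a
    / |w| and sine b / |w|. *)
Lemma cexp_clog w : 0 < complex.Re w -> cexp (clog w) = w.
Proof.
case: w => a b /= a0; rewrite /cexp/=.
have E : Num.sqrt (a ^+ 2 + b ^+ 2) = a * Num.sqrt (1 + (b / a) ^+ 2).
  rewrite -{2}(ger0_norm (ltW a0)) -sqrtr_sqr -sqrtrM ?sqr_ge0//.
  by congr Num.sqrt; field; rewrite gt_eqF.
have q0 : 0 < Num.sqrt (1 + (b / a) ^+ 2).
  by rewrite sqrtr_gt0 ltr_pwDl// sqr_ge0.
rewrite lnK ?posrE; last by rewrite E mulr_gt0.
rewrite sin_atan cos_atan E mulfK ?gt_eqF//; congr (_ +i* _).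
by rewrite mulrCA mulfK ?gt_eqF// divfK// gt_eqF.
Qed.

Lemma atan_le x : 0 <= x -> atan x <= x.
Proof.
move=> x0.
have [c _] : exists2 c, c \in `[0, x]%R & atan x - atan 0 = (1 + c ^+ 2)^-1 * (x - 0).
  apply: MVT_segment => //.
  by apply: continuous_subspaceT => c; exact: continuous_atan.
rewrite atan0 !subr0 => ->; rewrite ler_piMl// invf_le1; last first.
  by rewrite ltr_pwDl// sqr_ge0.
by rewrite lerDl sqr_ge0.
Qed.

Lemma norm_atan_le x : `|atan x| <= `|x|.
Proof.
wlog x0 : x / 0 <= x => [h|].
  have [/h//|/ltW x0] := leP 0 x.
  by rewrite -normrN -atanN -(normrN x); apply: h; rewrite oppr_ge0.
rewrite (ger0_norm x0) ger0_norm ?atan_le//.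
by rewrite -(atan0 R); exact: le_atan.
Qed.

Lemma Re_lt_norm z : normc z < 1 -> 0 < 1 - complex.Re z.
Proof.
by move=> z1; rewrite subr_gt0; apply: le_lt_trans z1; rewrite (le_trans _ (ger_Re z))// ler_norm.
Qed.

Lemma geomE_Re z : complex.Re (1 - z)^-1 =
  (1 - complex.Re z) / ((1 - complex.Re z) ^+ 2 + (complex.Im z) ^+ 2).
Proof. by case: z => a b /=; rewrite sub0r sqrrN. Qed.

Lemma geomE_Im z : complex.Im (1 - z)^-1 =
  complex.Im z / ((1 - complex.Re z) ^+ 2 + (complex.Im z) ^+ 2).
Proof. by case: z => a b /=; rewrite sub0r sqrrN mulNr opprK. Qed.

Lemma Re_geom_gt0 z : normc z < 1 -> 0 < complex.Re (1 - z)^-1.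
Proof.
move=> /Re_lt_norm h; rewrite geomE_Re divr_gt0// ltr_pwDl ?sqr_ge0//.
by rewrite exprn_gt0.
Qed.

Lemma Re_clog w : complex.Re (clog w) = ln (normc w). Proof. by case: w. Qed.
Lemma Im_clog w : complex.Im (clog w) = atan (complex.Im w / complex.Re w).
Proof. by case: w. Qed.

Lemma Im_clog_geom z : normc z < 1 -> complex.Im (clog (1 - z)^-1) =
  atan (complex.Im z / (1 - complex.Re z)).
Proof.
move=> z1; have h := Re_lt_norm z1.
rewrite Im_clog geomE_Re geomE_Im; congr atan; field.
by rewrite !gt_eqF//= ltr_pwDl ?sqr_ge0// exprn_gt0.
Qed.

Lemma Re_clog_geom z : complex.Re (clog (1 - z)^-1) = - ln (normc (1 - z)).
Proof.
rewrite Re_clog Normc.normcV; have [->|/eqP n0] := eqVneq (normc (1 - z)) 0.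
  by rewrite invr0 ln0// oppr0.
by rewrite lnV// posrE lt_neqAle normc_ge0 eq_sym andbT; apply/eqP.
Qed.

(** The linear bound lets the series of logarithms be dominated by the Dirichlet series of the
    multiplicities. For the real part, ln t <= t - 1 is applied to |1 - z| and to its inverse, which
    is at most 1 + 2|z| when |z| <= 1/2; for the imaginary part, 1 - Re z >= 1/2. *)
Lemma norm_clog_geom z : normc z <= 2^-1 ->
  `|complex.Re (clog (1 - z)^-1)| <= 2 * normc z /\
  `|complex.Im (clog (1 - z)^-1)| <= 2 * normc z.
Proof.
move=> z2; have z1 : normc z < 1 by lra.
have z0 := normc_ge0 z.
have n1 : normc 1 = 1 :> R := Normc.normc1 R.
have lb : 1 - normc z <= normc (1 - z).
  by have := le_normcD (1 - z) z; rewrite subrK n1; lra.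
have ub : normc (1 - z) <= 1 + normc z.
  by have := le_normcD 1 (- z); rewrite n1 normcN.
have p0 : 0 < normc (1 - z) by lra.
split.
  rewrite Re_clog_geom normrN ler_norml; apply/andP; split.
    rewrite -lerN2 opprK -lnV//.
    have -> : (normc (1 - z))^-1 = 1 + ((normc (1 - z))^-1 - 1) by ring.
    have h : (normc (1 - z))^-1 <= 1 + 2 * normc z.
      rewrite invf_ple ?posrE//; last by lra.
      apply: le_trans lb; rewrite -[leLHS]mul1r ler_pdivrMr; nra.
    apply: le_trans (le_ln1Dx _) _; last by lra.
    have : 0 < (normc (1 - z))^-1 by rewrite invr_gt0.
    lra.
  have -> : normc (1 - z) = 1 + (normc (1 - z) - 1) by ring.
  apply: le_trans (le_ln1Dx _) _; lra.
rewrite Im_clog_geom//; apply: le_trans (norm_atan_le _) _.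
have := ger_Re z; have := ger_Im z; have h := Re_lt_norm z1; move=> hi hr.
rewrite normrM normfV (gtr0_norm h) ler_pdivrMr//.
move: hr; rewrite ler_norml => /andP[_ hr]; nra.
Qed.

End Complex.

(** * Dirichlet series *)

Section DirichletReal.
Variable R : realType.
Implicit Types (s : R[i]) (x : R) (a : nat -> nat).

Lemma abel_sum (w f : nat -> R) n :
  \sum_(0 <= k < n.+1) w k * f k =
  \sum_(0 <= k < n) (\sum_(0 <= j < k.+1) w j) * (f k - f k.+1) +
  (\sum_(0 <= j < n.+1) w j) * f n.
Proof.
elim: n => [|n IH]; first by rewrite !big_nat1 big_geq// add0r.
rewrite big_nat_recr//= IH [in RHS]big_nat_recr//= [in RHS](big_nat_recr n.+1)//=.
ring.
Qed.

(** This turns a comparison of coefficient sums into a comparison of Dirichlet series with a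
    constant independent of the exponent. *)
Lemma abel_sum_ge0 (w f : nat -> R) n : w 0%N = 0 ->
  (forall n, 0 <= \sum_(0 <= k < n) w k) ->
  (forall n, 0 <= f n) -> (forall n, (0 < n)%N -> f n.+1 <= f n) ->
  0 <= \sum_(0 <= k < n) w k * f k.
Proof.
move=> w0 W0 f0 fd; case: n => [|n]; first by rewrite big_geq.
rewrite abel_sum addr_ge0 ?mulr_ge0//; apply: sumr_ge0 => -[|k] _.
  by rewrite big_nat1 w0 mul0r.
by rewrite mulr_ge0// subr_ge0 fd.
Qed.

(* n^-x; since [ln 0 = 0] its value at [n = 0] is 1, and the series below have a
   vanishing coefficient there. *)
Definition npow x n : R := expR (- x * ln n%:R).

Lemma npow_gt0 x n : 0 < npow x n. Proof. exact: expR_gt0. Qed.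

Lemma npow_ge0 x n : 0 <= npow x n. Proof. exact: expR_ge0. Qed.

Lemma npowM x m n : (0 < m)%N -> (0 < n)%N -> npow x (m * n) = npow x m * npow x n.
Proof.
by move=> m0 n0; rewrite /npow natrM lnM ?posrE ?ltr0n// mulrDr expRD.
Qed.

Lemma npow1 n : (0 < n)%N -> npow 1 n = n%:R^-1.
Proof. by move=> n0; rewrite /npow mulN1r expRN lnK// posrE ltr0n. Qed.

Lemma npowD x y n : npow (x + y) n = npow x n * npow y n.
Proof. by rewrite /npow opprD mulrDl expRD. Qed.

Lemma npow_le x m n : 0 <= x -> (0 < m)%N -> (m <= n)%N -> npow x n <= npow x m.
Proof.
move=> x0 m0 mn; rewrite ler_expR !mulNr lerN2 ler_wpM2l//.
by rewrite ler_ln ?posrE ?ltr0n ?ler_nat// (leq_trans m0).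
Qed.

Lemma npow_le1 x n : 0 <= x -> npow x n <= 1.
Proof.
move=> x0; rewrite -expR0 ler_expR mulNr oppr_le0 mulr_ge0//.
case: n => [|n]; first by rewrite ln0.
by rewrite ln_ge0// ler1n.
Qed.

Lemma npow_inv x n : 1 <= x -> (0 < n)%N -> npow x n <= n%:R^-1.
Proof.
move=> x1 n0; rewrite -npow1// -(subrK 1 x) npowD ler_piMl ?npow_ge0//.
by rewrite npow_le1// subr_ge0.
Qed.

(** Discrete form of integrating (x - 1) t^-x over [n, n+1]. It follows from ln(n+1) - ln n >=
    1/(n+1) and e^t >= 1 + t. *)
Lemma npow_telescope x n : 1 < x -> (0 < n)%N ->
  (x - 1) * npow x n.+1 <= npow (x - 1) n - npow (x - 1) n.+1.
Proof.
move=> x1 n0; rewrite lerBrDr.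
have -> : npow x n.+1 = npow (x - 1) n.+1 / n.+1%:R.
  by rewrite -npow1// -npowD subrK.
have n1 : n.+1%:R != 0 :> R by rewrite pnatr_eq0.
have n2 : 0 < n.+1%:R :> R by rewrite ltr0n.
have n3 : 0 < n%:R :> R by rewrite ltr0n.
have L : n.+1%:R^-1 <= ln n.+1%:R - ln n%:R :> R.
  rewrite -lerN2 opprB -ln_div ?posrE//.
  have -> : n%:R / n.+1%:R = 1 + (- n.+1%:R^-1) :> R.
    by rewrite -natr1; field; rewrite natr1.
  by apply: le_ln1Dx; rewrite ltrN2 invf_lt1// ltr1n ltnS.
have -> : npow (x - 1) n = npow (x - 1) n.+1 * expR ((x - 1) * (ln n.+1%:R - ln n%:R)).
  by rewrite /npow -expRD; congr expR; ring.
have := npow_gt0 (x - 1) n.+1; set p := npow _ _ => p0.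
have := expR_ge1Dx ((x - 1) * (ln n.+1%:R - ln n%:R)); set e := expR _ => eh.
apply: (@le_trans _ _ (p * (1 + (x - 1) * n.+1%:R^-1))).
  by rewrite le_eqVlt; apply/orP; left; apply/eqP; ring.
rewrite ler_wpM2l ?(ltW p0)//; apply: le_trans eh; rewrite lerD2l ler_wpM2l//.
by rewrite subr_ge0 ltW.
Qed.

Lemma zeta_bounded x n : 1 < x ->
  \sum_(0 <= k < n) (0 < k)%N%:R * npow x k <= 1 + (x - 1)^-1.
Proof.
move=> x1; have x10 : 0 < x - 1 by rewrite subr_gt0.
(* The telescoping remainder is kept so that the induction closes; it is discarded in [h']. *)
suff h m : \sum_(0 <= k < m.+2) (0 < k)%N%:R * npow x k
    <= 1 + (x - 1)^-1 * (1 - npow (x - 1) m.+1).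
  have h' m : \sum_(0 <= k < m.+2) (0 < k)%N%:R * npow x k <= 1 + (x - 1)^-1.
    apply: le_trans (h m) _; rewrite lerD2l ler_piMr ?invr_ge0 ?ltW//.
    by rewrite ltrBlDr ltrDl npow_gt0.
  apply: le_trans (h' n); rewrite [leRHS](big_cat_nat (n := n))//=; last by lia.
  by rewrite lerDl; apply: sumr_ge0 => i _; rewrite mulr_ge0// npow_ge0.
elim: m => [|m IH].
  rewrite big_nat_recr//= big_nat1/= mul0r add0r mul1r.
  by rewrite /npow ln1 !mulr0 expR0 subrr mulr0 addr0.
rewrite big_nat_recr//= mul1r; apply: le_trans (lerD IH (lexx _)) _.
rewrite -(mulKf (lt0r_neq0 x10) (npow x m.+2)).
apply: le_trans (lerD (lexx _) (ler_wpM2l _ (npow_telescope x1 (ltn0Sn m)))) _.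
  by rewrite invr_ge0 ltW.
by rewrite le_eqVlt; apply/orP; left; apply/eqP; ring.
Qed.

Lemma bounded_series_cvg (u : R^nat) C : (forall n, 0 <= u n) ->
  (forall n, series u n <= C) -> cvgn (series u).
Proof.
move=> u0 uC; apply: nondecreasing_is_cvgn.
  by apply: nondecreasing_series => n _ _; exact: u0.
by exists C => _ [n _ <-].
Qed.

Lemma series_le_lim (u : R^nat) n : (forall n, 0 <= u n) ->
  cvgn (series u) -> series u n <= limn (series u).
Proof.
move=> u0 uc; apply: nondecreasing_cvgn_le => //.
by apply: nondecreasing_series => k _ _; exact: u0.
Qed.

Definition dterm a x : R^nat := fun n => (a n)%:R * npow x n.

Lemma dterm_ge0 a x n : 0 <= dterm a x n.
Proof. by rewrite mulr_ge0// npow_ge0. Qed.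

(** Self-bounding: with r = g^-x < 1, the partial sums satisfy B(N) <= B(gN) = A(gN) + r B(N), hence
    (1 - r) B(N) is at most the sum of the series for a. *)
Lemma geom_conv_cvg g a x : (1 < g)%N -> a 0%N = 0%N -> 1 < x ->
  cvgn (series (dterm a x)) -> cvgn (series (dterm (geom_conv g a) x)).
Proof.
move=> g1 a0 x1 ac; set l := limn (series (dterm a x)).
have r1 : npow x g < 1.
  apply: le_lt_trans (npow_inv (ltW x1) (ltnW g1)) _.
  by rewrite invf_lt1 ?ltr0n ?ltr1n// ltnW.
apply: (@bounded_series_cvg _ (l / (1 - npow x g))) => [n|N]; first exact: dterm_ge0.
rewrite ler_pdivlMr ?subr_gt0// mulrBr mulr1 lerBlDr.
have E := geom_conv_sum N g1 a0 (fun n n0 => npowM x (ltnW g1) n0).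
apply: (@le_trans _ _ (series (dterm (geom_conv g a) x) (g * N)%N)).
  rewrite /series/= [leRHS](big_cat_nat (n := N))//=; last by rewrite leq_pmull// ltnW.
  by rewrite lerDl sumr_ge0// => i _; exact: dterm_ge0.
rewrite /series/= [leLHS]E mulrC lerD2r.
apply: (series_le_lim _ _ ac) => n; exact: dterm_ge0.
Qed.

Lemma iter_geom_conv_cvg g a x k : (1 < g)%N -> a 0%N = 0%N -> 1 < x ->
  cvgn (series (dterm a x)) -> cvgn (series (dterm (iter k (geom_conv g) a) x)).
Proof.
move=> g1 a0 x1 ac; elim: k => // k IH /=; apply: geom_conv_cvg => //.
exact: iter_geom_conv0.
Qed.

Lemma euler_coef_cvg m K x : 1 < x -> cvgn (series (dterm (euler_coef m K) x)).
Proof.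
move=> x1.
have h : cvgn (series (dterm (fun n => (n == 1%N) : nat) x)).
  apply: (@bounded_series_cvg _ (1 + (x - 1)^-1)) => [n|N]; first exact: dterm_ge0.
  apply: le_trans (zeta_bounded N x1); apply: ler_sum => -[|i] _.
    by rewrite /dterm mul0r.
  rewrite ler_wpM2r ?npow_ge0// ler_nat.
  by case: (_ == _).
elim: K => [|[|K] IH]//; rewrite euler_coefSS.
by apply: iter_geom_conv_cvg => //; exact: euler_coef0.
Qed.

End DirichletReal.

(** * Complex Dirichlet series and their Euler products *)

Section DirichletComplex.
Variable R : realType.
Implicit Types (s z w : R[i]) (x : R) (a m : nat -> nat).

Definition ccvg (u : nat -> R[i]) (l : R[i]) : Prop :=
  (complex.Re (u n) @[n --> \oo] --> complex.Re l) /\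
  (complex.Im (u n) @[n --> \oo] --> complex.Im l).

Lemma ReM z w : complex.Re (z * w) =
  complex.Re z * complex.Re w - complex.Im z * complex.Im w.
Proof. by case: z w => [? ?] [? ?]. Qed.

Lemma ImM z w : complex.Im (z * w) =
  complex.Re z * complex.Im w + complex.Im z * complex.Re w.
Proof. by case: z w => [? ?] [? ?]. Qed.

Lemma ReB z w : complex.Re (z - w) = complex.Re z - complex.Re w.
Proof. by case: z w => [? ?] [? ?]. Qed.

Lemma ImB z w : complex.Im (z - w) = complex.Im z - complex.Im w.
Proof. by case: z w => [? ?] [? ?]. Qed.

Lemma Re_sum I (r : seq I) (F : I -> R[i]) :
  complex.Re (\sum_(i <- r) F i) = \sum_(i <- r) complex.Re (F i).
Proof. by apply: big_morph => // -[? ?] [? ?]. Qed.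

Lemma Im_sum I (r : seq I) (F : I -> R[i]) :
  complex.Im (\sum_(i <- r) F i) = \sum_(i <- r) complex.Im (F i).
Proof. by apply: big_morph => // -[? ?] [? ?]. Qed.

Lemma natcE k : k%:R = (k%:R : R)%:C. Proof. by rewrite rmorph_nat. Qed.

Lemma Re_natM k z : complex.Re (k%:R * z) = k%:R * complex.Re z.
Proof. by rewrite natcE ReM /= mul0r subr0. Qed.

Lemma Im_natM k z : complex.Im (k%:R * z) = k%:R * complex.Im z.
Proof. by rewrite natcE ImM /= mul0r addr0. Qed.

Lemma complex_ext z w : complex.Re z = complex.Re w ->
  complex.Im z = complex.Im w -> z = w.
Proof. by case: z w => [? ?] [? ?] /= -> ->. Qed.

Lemma ccvgM u v l l' : ccvg u l -> ccvg v l' ->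
  ccvg (fun n => u n * v n) (l * l').
Proof.
move=> [u1 u2] [v1 v2]; split.
  rewrite ReM; under eq_fun do rewrite ReM.
  by apply: cvgB; apply: cvgM.
rewrite ImM; under eq_fun do rewrite ImM.
by apply: cvgD; apply: cvgM.
Qed.

Lemma ccvgB u v l l' : ccvg u l -> ccvg v l' ->
  ccvg (fun n => u n - v n) (l - l').
Proof.
move=> [u1 u2] [v1 v2]; split.
  by rewrite ReB; under eq_fun do rewrite ReB; apply: cvgB.
by rewrite ImB; under eq_fun do rewrite ImB; apply: cvgB.
Qed.

Lemma ccvg_cst l : ccvg (fun=> l) l. Proof. by split; exact: cvg_cst. Qed.

Lemma ccvg_unique u l l' : ccvg u l -> ccvg u l' -> l = l'.
Proof.
move=> [u1 u2] [v1 v2]; apply: complex_ext.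
  exact: (cvg_unique _ u1 v1).
exact: (cvg_unique _ u2 v2).
Qed.

Lemma ccvg_comp u l (k : nat -> nat) : k n @[n --> \oo] --> \oo ->
  ccvg u l -> ccvg (u \o k) l.
Proof. by move=> kc [u1 u2]; split; [exact: cvg_comp kc u1|exact: cvg_comp kc u2]. Qed.

Lemma cvg_muln g : (0 < g)%N -> (g * n)%N @[n --> \oo] --> \oo.
Proof.
move=> g0; apply/cvgnyPge => A; near=> n.
by rewrite (@leq_trans n)// ?leq_pmull//; near: n; exists A.
Unshelve. all: by end_near. Qed.

Lemma ccvg_cexp u l : ccvg u l -> ccvg (fun n => cexp (u n)) (cexp l).
Proof.
have E z : cexp z = (expR (complex.Re z) * cos (complex.Im z)) +i*
  (expR (complex.Re z) * sin (complex.Im z)) by case: z.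
move=> [u1 u2]; rewrite E; split => /=.
  under eq_fun do rewrite E /=; apply: cvgM.
    by apply: continuous_cvg => //; exact: continuous_expR.
  by apply: continuous_cvg => //; exact: continuous_cos.
under eq_fun do rewrite E /=; apply: cvgM.
  by apply: continuous_cvg => //; exact: continuous_expR.
by apply: continuous_cvg => //; exact: continuous_sin.
Qed.

Definition dchar s n : R[i] := cpow n%:R (- s).

Lemma normc_dchar s n : normc (dchar s n) = npow (complex.Re s) n.
Proof.
rewrite /dchar /cpow normc_cexp /npow; congr expR.
by case: s => a b; rewrite ReM mulr0 subr0.
Qed.

Lemma dcharM s k n : (0 < k)%N -> (0 < n)%N ->
  dchar s (k * n) = dchar s k * dchar s n.
Proof.
move=> k0 n0; rewrite /dchar /cpow -cexpD -mulrDr -rmorphD/=.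
by rewrite natrM lnM// posrE ltr0n.
Qed.

Lemma dchar_real x n : dchar x%:C n = (npow x n)%:C.
Proof.
by rewrite /dchar /cpow -rmorphN -rmorphM cexp_real.
Qed.

Definition cseries a s N : R[i] := \sum_(0 <= n < N) (a n)%:R * dchar s n.

Lemma cseries_cvg a s : cvgn (series (dterm a (complex.Re s))) ->
  exists l, ccvg (cseries a s) l.
Proof.
move=> ac.
have h (F : R[i] -> R) : (forall z, `|F z| <= normc z) ->
    cvgn (series (fun n => (a n)%:R * F (dchar s n))).
  move=> FN; apply: normed_cvg; apply: series_le_cvg ac => [n|n|n].
  - exact: normr_ge0.
  - exact: dterm_ge0.
  by rewrite /= normrM normr_nat ler_wpM2l// -normc_dchar.
exists ((limn (series (fun n => (a n)%:R * complex.Re (dchar s n)))) +i*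
  (limn (series (fun n => (a n)%:R * complex.Im (dchar s n))))); split => /=.
  rewrite (_ : (fun n => _) = series (fun n => (a n)%:R * complex.Re (dchar s n))).
    by apply: h; exact: ger_Re.
  apply/funext => n; rewrite /cseries Re_sum /series/=.
  by apply: eq_bigr => i _; rewrite Re_natM.
rewrite (_ : (fun n => _) = series (fun n => (a n)%:R * complex.Im (dchar s n))).
  by apply: h; exact: ger_Im.
apply/funext => n; rewrite /cseries Im_sum /series/=.
by apply: eq_bigr => i _; rewrite Im_natM.
Qed.

Lemma npow_le_half x k : 1 < x -> (1 < k)%N -> npow x k <= 2^-1.
Proof.
move=> x1 k1; apply: le_trans (npow_inv (ltW x1) (ltnW k1)) _.
by rewrite lef_pV2 ?posrE ?ltr0n ?ler_nat// ltnW.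
Qed.

Lemma normc_dchar_lt1 s k : 1 < complex.Re s -> (1 < k)%N ->
  normc (dchar s k) < 1.
Proof.
move=> s1 k1; rewrite normc_dchar; apply: le_lt_trans (npow_le_half s1 k1) _.
lra.
Qed.

(** Absolute convergence gives some limit l'; passing to the limit in [geom_conv_sum] along N and g
    N gives l' - g^-s l' = l, which determines it. *)
Lemma cseries_geom g a s l : (1 < g)%N -> a 0%N = 0%N -> 1 < complex.Re s ->
  cvgn (series (dterm a (complex.Re s))) -> ccvg (cseries a s) l ->
  ccvg (cseries (geom_conv g a) s) ((1 - dchar s g)^-1 * l).
Proof.
move=> g1 a0 s1 ac al.
have [l' l'c] := cseries_cvg (geom_conv_cvg g1 a0 s1 ac).
have gc := cvg_muln (ltnW g1).
have E N : cseries (geom_conv g a) s (g * N)%N - dchar s g * cseries (geom_conv g a) s N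
   = cseries a s (g * N)%N.
  by rewrite /cseries geom_conv_sum// ?addrK// => n n0; rewrite dcharM// ltnW.
have h : l' - dchar s g * l' = l.
  apply: ccvg_unique (ccvg_comp gc al).
  rewrite (_ : _ \o _ = (fun N => cseries (geom_conv g a) s (g * N)%N -
     dchar s g * cseries (geom_conv g a) s N)); last by apply/funext => n; rewrite E.
  apply: ccvgB; first exact: (ccvg_comp gc l'c).
  by apply: ccvgM => //; exact: ccvg_cst.
suff -> : (1 - dchar s g)^-1 * l = l' by [].
rewrite -h -{1}(mul1r l') -mulrBl mulKf//.
rewrite subr_eq0; apply/eqP => e; have := normc_dchar_lt1 s1 g1.
by rewrite -e Normc.normc1 ltxx.
Qed.

Definition geomlog s k : R[i] := clog (1 - dchar s k)^-1.

Lemma cexp_geomlog s k : 1 < complex.Re s -> (1 < k)%N ->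
  cexp (geomlog s k) = (1 - dchar s k)^-1.
Proof.
by move=> s1 k1; rewrite cexp_clog// Re_geom_gt0// normc_dchar_lt1.
Qed.

Definition logsum m s K : R[i] := \sum_(0 <= k < K) (m k)%:R * geomlog s k.

Lemma cseries_euler m K s : m 0%N = 0%N -> m 1%N = 0%N -> 1 < complex.Re s ->
  ccvg (cseries (euler_coef m K) s) (cexp (logsum m s K.+1)).
Proof.
move=> m0 m1 s1.
have h1 : ccvg (cseries (fun n => (n == 1%N) : nat) s) 1.
  have E N : cseries (fun n => (n == 1%N) : nat) s N.+2 = 1.
    rewrite /cseries big_nat_recl//= big_nat_recl//= mul0r add0r big1.
      by rewrite addr0 mul1r /dchar /cpow ln1 mulr0 cexp0.
    by move=> i _; rewrite mul0r.
  by split; apply: cvg_near_cst; exists 2%N => // -[|[|n]]//= _; rewrite E.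
elim: K => [|[|K] IH].
- by rewrite /logsum big_nat1 m0 mul0r cexp0.
- by rewrite /logsum big_nat_recr//= big_nat1 m0 m1 !mul0r addr0 cexp0.
rewrite euler_coefSS; have := @euler_coef_cvg _ m K.+1 _ s1; have := euler_coef0 m K.+1.
move: (euler_coef m K.+1) IH => a IH a0 ac.
rewrite /logsum big_nat_recr//= cexpD mulrC -/(logsum m s K.+2).
elim: (m K.+2) => [|k IHk]; first by rewrite mul0r cexp0 mul1r.
rewrite -natr1 mulrDl mul1r addrC cexpD cexp_geomlog// -mulrA /=.
apply: cseries_geom => //; first by rewrite iter_geom_conv0.
exact: iter_geom_conv_cvg.
Qed.

(* [ell x 1 = 0] because [ln 0 = 0]: multiplicities have to vanish at 1. *)
Definition ell x k : R := - ln (1 - npow x k).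

Lemma geomlog_real x k : 1 < x -> (1 < k)%N -> geomlog x%:C k = (ell x k)%:C.
Proof.
move=> x1 k1; have x1' : 1 < complex.Re x%:C by [].
have := normc_dchar_lt1 x1' k1; rewrite normc_dchar/= => p1.
apply: complex_ext; rewrite /geomlog.
  rewrite Re_clog_geom dchar_real /ell.
  have -> : 1 - (npow x k)%:C = (1 - npow x k)%:C by rewrite rmorphB rmorph1.
  rewrite /= expr0n addr0 sqrtr_sqr.
  by rewrite ger0_norm// subr_ge0 ltW.
by rewrite Im_clog_geom ?normc_dchar_lt1// dchar_real/= mul0r atan0.
Qed.

Lemma ell_ge0 x k : 0 <= x -> 0 <= ell x k.
Proof.
by move=> x0; rewrite oppr_ge0 ln_le0// lerBlDr lerDl npow_ge0.
Qed.

Lemma ell_le x k : 1 < x -> (1 < k)%N -> ell x k <= 2 * npow x k.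
Proof.
move=> x1 k1.
have h0 : normc (dchar x%:C k) <= 2^-1 by rewrite normc_dchar npow_le_half.
have [+ _] := norm_clog_geom h0.
 rewrite -/(geomlog _ _) geomlog_real// normc_dchar /=.
exact: le_trans (ler_norm _).
Qed.

Lemma geomlog_le s k : 1 < complex.Re s -> (1 < k)%N ->
  `|complex.Re (geomlog s k)| <= 2 * npow (complex.Re s) k /\
  `|complex.Im (geomlog s k)| <= 2 * npow (complex.Re s) k.
Proof.
move=> s1 k1; rewrite -normc_dchar; apply: norm_clog_geom.
by rewrite normc_dchar npow_le_half.
Qed.

Definition lterm m x : R^nat := fun k => (m k)%:R * ell x k.

Lemma lterm_ge0 m x k : 0 <= x -> 0 <= lterm m x k.
Proof. by move=> x0; rewrite mulr_ge0// ell_ge0. Qed.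

Section Generators.
Variable m : nat -> nat.
Hypothesis m0 : m 0%N = 0%N.
Hypothesis m1 : m 1%N = 0%N.
Hypothesis mc : forall x, 1 < x -> cvgn (series (dterm m x)).

Let dterm2_cvg x : 1 < x -> cvgn (series (fun n => 2 * dterm m x n)).
Proof. by move=> x1; exact: (is_cvg_seriesZ (mc x1)). Qed.

Lemma lterm_cvg x : 1 < x -> cvgn (series (lterm m x)).
Proof.
move=> x1; have x0 : 0 <= x by lra.
apply: (@series_le_cvg _ _ (fun n => 2 * dterm m x n)).
- by move=> n; exact: lterm_ge0.
- by move=> n; rewrite /= mulr_ge0// dterm_ge0.
- move=> [|[|n]]; rewrite /lterm /dterm ?m0 ?m1 ?mul0r ?mulr0//.
  by rewrite mulrCA ler_wpM2l// ell_le.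
- exact: dterm2_cvg.
Qed.

Lemma logsum_real x K : 1 < x -> logsum m x%:C K = (series (lterm m x) K)%:C.
Proof.
move=> x1; rewrite /logsum /series /= rmorph_sum/=; apply: eq_bigr => -[|[|i]] _;
  rewrite /lterm ?m0 ?m1 ?mul0r//.
by rewrite geomlog_real// rmorphM/= rmorph_nat.
Qed.

(** The bound depends on neither K nor N. Taking K = N, where the truncated and full coefficients
    agree below N, it gives convergence of the full series before its sum is known. *)
Lemma dterm_euler_le x K N : 1 < x ->
  series (dterm (euler_coef m K) x) N <= expR (limn (series (lterm m x))).
Proof.
move=> x1; have x1' : 1 < complex.Re x%:C by [].
have [+ _] := cseries_euler K m0 m1 x1'.
rewrite logsum_real// cexp_real/=.
have -> : (fun n => complex.Re (cseries (euler_coef m K) x%:C n)) =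
    series (dterm (euler_coef m K) x).
  apply/funext => n; rewrite /cseries Re_sum; apply: eq_bigr => i _.
  by rewrite Re_natM dchar_real.
move=> c; have cc : cvgn (series (dterm (euler_coef m K) x)) by exact: cvgP c.
apply: (@le_trans _ _ (expR (series (lterm m x) K.+1))).
  rewrite -(cvg_lim _ c)//; apply: series_le_lim => // n; exact: dterm_ge0.
rewrite ler_expR; apply: series_le_lim => [n|]; last exact: lterm_cvg.
by apply: lterm_ge0; lra.
Qed.

Lemma beurling_coef_le x N : 1 < x ->
  series (dterm (beurling_coef m) x) N <= expR (limn (series (lterm m x))).
Proof.
move=> x1; apply: le_trans (dterm_euler_le N N x1).
rewrite /series/= !big_nat; apply: ler_sum => i /andP[_ iN].
by rewrite /dterm euler_coef_beurling// ltnW.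
Qed.

Lemma beurling_coef_cvg x : 1 < x -> cvgn (series (dterm (beurling_coef m) x)).
Proof.
move=> x1; apply: bounded_series_cvg => [n|n]; first exact: dterm_ge0.
exact: beurling_coef_le.
Qed.

Lemma logsum_cvg s : 1 < complex.Re s -> exists l, ccvg (logsum m s) l.
Proof.
move=> s1.
have h (F : R[i] -> R) : (forall k, (1 < k)%N ->
      `|F (geomlog s k)| <= 2 * npow (complex.Re s) k) ->
    cvgn (series (fun n => (m n)%:R * F (geomlog s n))).
  move=> FN; apply: normed_cvg; apply: (@series_le_cvg _ _ (fun n => 2 * dterm m (complex.Re s) n)) => [n|n|n|].
  - exact: normr_ge0.
  - by rewrite /= mulr_ge0// dterm_ge0.
  - rewrite /= normrM normr_nat /dterm mulrCA.
    case: n => [|[|n]]; rewrite ?m0 ?m1 ?mul0r//.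
    by rewrite ler_wpM2l// FN.
  - exact: dterm2_cvg.
exists ((limn (series (fun n => (m n)%:R * complex.Re (geomlog s n)))) +i*
  (limn (series (fun n => (m n)%:R * complex.Im (geomlog s n))))); split => /=.
  rewrite (_ : (fun n => _) = series (fun n => (m n)%:R * complex.Re (geomlog s n))).
    by apply: h => k k1; have [] := geomlog_le s1 k1.
  apply/funext => n; rewrite /logsum Re_sum /series/=.
  by apply: eq_bigr => i _; rewrite Re_natM.
rewrite (_ : (fun n => _) = series (fun n => (m n)%:R * complex.Im (geomlog s n))).
  by apply: h => k k1; have [] := geomlog_le s1 k1.
apply/funext => n; rewrite /logsum Im_sum /series/=.
by apply: eq_bigr => i _; rewrite Im_natM.
Qed.

(** Truncating the product at K leaves the coefficients up to K unchanged, and beyond K the error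
    lies between 0 and the full coefficient. F stands for the real or the imaginary part. *)
Lemma cseries_tail s K N (F : R[i] -> R) : 1 < complex.Re s ->
  (forall z, `|F z| <= normc z) -> (K < N)%N ->
  `|\sum_(0 <= n < N) (beurling_coef m n)%:R * F (dchar s n) -
    \sum_(0 <= n < N) (euler_coef m K n)%:R * F (dchar s n)| <=
  limn (series (dterm (beurling_coef m) (complex.Re s))) -
  series (dterm (beurling_coef m) (complex.Re s)) K.+1.
Proof.
move=> s1 FN KN; rewrite -sumrB; apply: le_trans (ler_norm_sum _ _ _) _.
apply: (@le_trans _ _ (\sum_(K.+1 <= n < N) dterm (beurling_coef m) (complex.Re s) n)).
  rewrite (big_cat_nat (n := K.+1))//= big_nat_cond big1 ?add0r.
    apply: ler_sum => i _; rewrite -mulrBl normrM /dterm -normc_dchar.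
    rewrite ler_pM// ger0_norm ?subr_ge0 ?ler_nat ?euler_coef_le//.
    by rewrite gerBl.
  move=> i /andP[/andP[_ iK] _].
  by rewrite (euler_coef_beurling m (K := K))// subrr normr0.
rewrite lerBrDl; apply: le_trans (series_le_lim N _ (beurling_coef_cvg s1)).
  by rewrite /series/= [leRHS](big_cat_nat (n := K.+1)).
by move=> n; exact: dterm_ge0.
Qed.

Lemma cseries_beurling s l : 1 < complex.Re s -> ccvg (logsum m s) l ->
  ccvg (cseries (beurling_coef m) s) (cexp l).
Proof.
move=> s1 sl; have [d dc] := cseries_cvg (beurling_coef_cvg s1).
have ec : ccvg (fun K => cexp (logsum m s K.+1)) (cexp l).
  by apply: ccvg_cexp; split; [case: sl => + _|case: sl => _ +]; rewrite -cvg_shiftS.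
set T := limn (series (dterm (beurling_coef m) (complex.Re s))).
have tail0 : T - series (dterm (beurling_coef m) (complex.Re s)) K.+1 @[K --> \oo] --> 0.
  rewrite -(subrr T); apply: cvgB; first exact: cvg_cst.
  by rewrite cvg_shiftS; exact: (beurling_coef_cvg s1).
(* Iterated limit, N first and then K: at fixed K the tail bound survives N -> oo, and it vanishes
   as K -> oo. *)
have key (F : R[i] -> R) : (forall z, `|F z| <= normc z) ->
    (forall a n, F (cseries a s n) = \sum_(0 <= n < n) (a n)%:R * F (dchar s n)) ->
    (forall u z, ccvg u z -> F (u n) @[n --> \oo] --> F z) -> F d = F (cexp l).
  move=> FN FS Fc.
  have h K : `|F d - F (cexp (logsum m s K.+1))| <=
      T - series (dterm (beurling_coef m) (complex.Re s)) K.+1.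
    have c : `|F (cseries (beurling_coef m) s N) - F (cseries (euler_coef m K) s N)|
        @[N --> \oo] --> `|F d - F (cexp (logsum m s K.+1))|.
      apply: cvg_norm; apply: cvgB; first exact: Fc.
      by apply: (Fc (cseries (euler_coef m K) s)); exact: cseries_euler.
    apply: (cvgr_to_le c); exists K.+1 => // N /= KN.
    by rewrite !FS; exact: cseries_tail.
  have c1 : F d - F (cexp (logsum m s K.+1)) @[K --> \oo] --> F d - F (cexp l).
    by apply: cvgB; [exact: cvg_cst|exact: Fc ec].
  have c2 : F d - F (cexp (logsum m s K.+1)) @[K --> \oo] --> 0.
    apply/cvgr0Pnorm_le => e e0; move/cvgr0Pnorm_le/(_ e e0): tail0.
    apply: filterS => K /(le_trans (ler_norm _)); exact: le_trans (h K).
  by apply/eqP; rewrite -subr_eq0; apply/eqP; exact: (cvg_unique _ c1 c2).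
suff <- : d = cexp l by [].
apply: complex_ext; apply: key => [z|a n|u z []//].
- exact: ger_Re.
- by rewrite Re_sum; apply: eq_bigr => i _; rewrite Re_natM.
- exact: ger_Im.
- by rewrite Im_sum; apply: eq_bigr => i _; rewrite Im_natM.
Qed.

Lemma beurling_lim x : 1 < x ->
  limn (series (dterm (beurling_coef m) x)) = expR (limn (series (lterm m x))).
Proof.
move=> x1; have x1' : 1 < complex.Re x%:C by [].
have lc : ccvg (logsum m x%:C) (limn (series (lterm m x)))%:C.
  split => /=.
    under eq_fun do rewrite logsum_real//=.
    exact: lterm_cvg.
  by under eq_fun do rewrite logsum_real//=; exact: cvg_cst.
have [+ _] := cseries_beurling x1' lc.
rewrite cexp_real/= => c; apply: cvg_lim => //.
rewrite (_ : series _ = (fun n => complex.Re (cseries (beurling_coef m) x%:C n)))//.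
apply/funext => n; rewrite /cseries Re_sum; apply: eq_bigr => i _.
by rewrite Re_natM dchar_real.
Qed.

End Generators.
End DirichletComplex.

(** * Stieltjes measures of step functions *)

Section StepMeasure.
Variable R : realType.
Implicit Types (c : nat -> nat) (D : set R).

Definition step c (x : R) : R := \sum_(0 <= n < (Num.truncn x).+1) (c n)%:R.

Lemma step_nat c n : step c n%:R = \sum_(0 <= k < n.+1) (c k)%:R.
Proof. by rewrite /step natrK. Qed.

Lemma step_nondecreasing c : nondecreasing (step c).
Proof.
move=> x y xy; rewrite /step [leRHS](big_cat_nat (n := (Num.truncn x).+1))//=.
  by rewrite lerDl sumr_ge0.
by rewrite ltnS le_truncn.
Qed.

Lemma step_right_continuous c : right_continuous (step c).
Proof.
move=> x; apply: cvg_near_cst; near=> z.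
rewrite /step; congr (\sum_(0 <= n < _.+1) _).
have xz : x < z by near: z; exact: nbhs_right_gt.
apply/eqP; rewrite eqn_leq (le_truncn (ltW xz)) andbT truncn_le_nat.
by near: z; apply: nbhs_right_lt; exact: truncnS_gt.
Unshelve. all: by end_near. Qed.

HB.instance Definition _ c := isCumulative.Build R _ R (step c)
  (@step_nondecreasing c) (@step_right_continuous c).

Definition atomic c : {measure set (measurableTypeR R) -> \bar R} :=
  mseries (fun n => mscale (c n)%:R%:nng (dirac (n%:R : measurableTypeR R))) 0.

Lemma step_sub c (a b : R) : c 0%N = 0%N -> a <= b ->
  step c b - step c a = \sum_(0 <= n < (Num.truncn b).+1) (c n)%:R * (a < n%:R <= b)%R%:R.
Proof.
move=> c0 ab; apply/eqP; rewrite subr_eq; apply/eqP.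
rewrite /step [in RHS](big_cat_nat (n := (Num.truncn a).+1))//=; last first.
  by rewrite ltnS le_truncn.
rewrite [X in _ = X + _ + _]big_nat_cond [X in _ = X + _ + _]big1 ?add0r.
  rewrite [in LHS](big_cat_nat (n := (Num.truncn a).+1))//=; last first.
    by rewrite ltnS le_truncn.
  rewrite addrC; congr +%R; rewrite !big_nat; apply: eq_bigr => i /andP[ai bi].
  case: i ai bi => // i ai bi.
  rewrite ltnS truncn_gt_nat in bi.
  by rewrite bi -truncn_le_nat -ltnS ai mulr1.
move=> [|i] /andP[/andP[_ ia] _]; first by rewrite c0 mul0r.
by move: ia; rewrite ltnS truncn_gt_nat => /le_gtF -> /=; rewrite mulr0.
Qed.

(** Both measures agree on the intervals ]a, b], which determines them. Since [truncn] is 0 on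
    negative numbers, [step c] does not jump at 0, whereas [atomic c] has mass c 0 there; hence the
    condition on c 0. *)
Lemma stieltjes_step c : c 0%N = 0%N -> forall A, measurable A ->
  lebesgue_stieltjes_measure (step c) A = atomic c A.
Proof.
move=> c0; apply: lebesgue_stieltjes_measure_unique => X [[a b] _ <-] /=.
have mab : measurable (`]a, b]%classic : set (measurableTypeR R)).
  exact: measurable_itv.
rewrite /lebesgue_stieltjes_measure /measure_extension measurable_mu_extE/=; last by exists (a, b).
have E n : (mscale (c n)%:R%:nng (dirac (n%:R : measurableTypeR R)) `]a, b]%classic
    = ((c n)%:R * (a < n%:R <= b)%R%:R)%:E).
  rewrite /mscale/= diracE -EFinM; congr ((_ * _%:R)%:E).
  by rewrite mem_setE in_itv.
rewrite /atomic /= /mseries.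
have [ab|ba] := leP a b; last first.
  rewrite set_itv_ge -?leNgt ?bnd_simp ?ltW//= wlength0.
  by under eq_eseriesr do rewrite measure0; rewrite eseries0.
rewrite wlength_itv_bnd// step_sub//; apply/esym/cvg_lim => //.
apply: cvg_near_cst; exists (Num.truncn b).+1 => // N /= bN.
rewrite (big_cat_nat (n := (Num.truncn b).+1))//=.
under eq_bigr do rewrite E.
rewrite sumEFin [X in (_ + X)%E]big_nat_cond [X in (_ + X)%E]big1 ?adde0//.
move=> i /andP[/andP[bi _] _]; rewrite E.
case: i bi => // i; rewrite ltnS => bi.
by rewrite -truncn_gt_nat ltnNge bi andbF mulr0.
Qed.


Section StepIntegral.
Variables (c : nat -> nat) (D : set R).
Hypothesis c0 : c 0%N = 0%N.
Hypothesis mD : measurable D.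
Hypothesis cD : forall n, c n != 0%N -> D n%:R.

Local Notation mu := (lebesgue_stieltjes_measure (step c)).

Lemma ge0_integral_step (g : R -> R) : measurable_fun D g ->
  (forall x, D x -> 0 <= g x) -> cvgn (series (fun n => (c n)%:R * g n%:R)) ->
  (\int[mu]_(x in D) (g x)%:E = (limn (series (fun n => (c n)%:R * g n%:R)))%:E)%E.
Proof.
move=> mg g0 gc.
have mg' : measurable_fun D (EFin \o g).
  by apply/measurable_EFinP.
have g0' x : D x -> (0 <= (g x)%:E)%E by move=> /g0; rewrite lee_fin.
rewrite (@eq_measure_integral _ (measurableTypeR R) R D (atomic c)); last first.
  by move=> A mA _; exact: stieltjes_step.
rewrite ge0_integral_measure_series//.
rewrite -EFin_lim//; congr (limn _); apply/funext => N /=.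
rewrite /series/= -sumEFin; apply: eq_bigr => n _.
rewrite ge0_integral_mscale//= integral_dirac//= diracE.
have [->|/cD Dn] := eqVneq (c n) 0%N; first by rewrite mul0e mul0r.
by rewrite mem_set// mul1e EFinM.
Qed.

Lemma integral_step (g : R -> R) : measurable_fun D g ->
  cvgn (series (fun n => (c n)%:R * `|g n%:R|)) ->
  mu.-integrable D (EFin \o g) /\
  series (fun n => (c n)%:R * g n%:R) n @[n --> \oo] --> Rintegral mu D g.
Proof.
move=> mg gc.
have mn : measurable_fun D (fun x => `|g x|) by exact: measurableT_comp.
have part (h : R -> R) : measurable_fun D h -> (forall x, 0 <= h x <= `|g x|) ->
    (\int[mu]_(x in D) (h x)%:E = (limn (series (fun n => (c n)%:R * h n%:R)))%:E)%E /\
    cvgn (series (fun n => (c n)%:R * h n%:R)).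
  move=> mh hg.
  have hc : cvgn (series (fun n => (c n)%:R * h n%:R)).
    apply: series_le_cvg gc => n.
    - by rewrite mulr_ge0//; have /andP[] := hg n%:R.
    - by rewrite mulr_ge0.
    - by rewrite ler_wpM2l//; have /andP[] := hg n%:R.
  split=> //; apply: ge0_integral_step => // x _.
  by have /andP[] := hg x.
split.
  apply/integrableP; split; first exact/measurable_EFinP.
  have h x : 0 <= `|g x| <= `|g x| by rewrite normr_ge0 lexx.
  by have [+ _] := part _ mn h; rewrite /= => ->; rewrite ltry.
pose gp x := Num.max (g x) 0; pose gn x := Num.max (- g x) 0.
have [pE pc] : (\int[mu]_(x in D) (gp x)%:E = (limn (series (fun n => (c n)%:R * gp n%:R)))%:E)%E /\
    cvgn (series (fun n => (c n)%:R * gp n%:R)).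
  apply: part; first exact: measurable_maxr.
  by move=> x; rewrite /gp le_max lexx orbT ge_max ler_norm normr_ge0.
have [nE nc] : (\int[mu]_(x in D) (gn x)%:E = (limn (series (fun n => (c n)%:R * gn n%:R)))%:E)%E /\
    cvgn (series (fun n => (c n)%:R * gn n%:R)).
  apply: part; first by apply: measurable_maxr => //; exact: measurableT_comp.
  by move=> x; rewrite /gn le_max lexx orbT ge_max -normrN ler_norm normr_ge0.
have gE x : g x = gp x - gn x.
  rewrite /gp /gn; case: (leP (g x) 0) => h.
    by rewrite max_l ?oppr_ge0// sub0r opprK.
  by rewrite max_r ?subr0// oppr_le0 ltW.
rewrite /Rintegral integralE.
rewrite (_ : \int[mu]_(x in D) _ = \int[mu]_(x in D) (gp x)%:E)%E; last first.
  by apply: eq_integral => x _; rewrite funeposE /gp -EFin_max.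
rewrite (_ : \int[mu]_(x in D) _^\- x = \int[mu]_(x in D) (gn x)%:E)%E; last first.
  by apply: eq_integral => x _; rewrite funenegE /gn -EFinN -EFin_max.
rewrite pE nE -EFinB /=.
have -> : series (fun n => (c n)%:R * g n%:R) =
    series (fun n => (c n)%:R * gp n%:R) - series (fun n => (c n)%:R * gn n%:R).
  apply/funext => N; rewrite /series/= -[RHS]sumrB; apply: eq_bigr => n _.
  by rewrite -mulrBr -gE.
exact: cvgB pc nc.
Qed.

End StepIntegral.
End StepMeasure.

(** * The counting function N of a step function *)

Section CalN.
Variable R : realType.
Implicit Types (s z w : R[i]) (x : R).

Lemma Re_cpow x s : complex.Re (cpow x (- s)) =
  expR (- complex.Re s * ln x) * cos (- complex.Im s * ln x).
Proof. by case: s => a b; rewrite /cpow /cexp/= !mulr0 subr0 add0r. Qed.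

Lemma Im_cpow x s : complex.Im (cpow x (- s)) =
  expR (- complex.Re s * ln x) * sin (- complex.Im s * ln x).
Proof. by case: s => a b; rewrite /cpow /cexp/= !mulr0 subr0 add0r. Qed.

Lemma normc_cpow x s : normc (cpow x (- s)) = expR (- complex.Re s * ln x).
Proof. by case: s => a b; rewrite /cpow normc_cexp/= mulr0 subr0. Qed.

Lemma measurable_Mln (k : R) : measurable_fun setT (fun x : R => k * ln x).
Proof. by apply: measurable_funM => //; exact: measurable_ln. Qed.

Lemma measurable_Re_cpow s :
  measurable_fun setT (fun x : R => complex.Re (cpow x (- s))).
Proof.
under eq_fun do rewrite Re_cpow; apply: measurable_funM.
  by apply: (measurableT_comp (@measurable_expR R)); exact: measurable_Mln.
apply: (measurableT_comp (f := cos)); last exact: measurable_Mln.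
by apply: continuous_measurable_fun => ?; exact: continuous_cos.
Qed.

Lemma measurable_Im_cpow s :
  measurable_fun setT (fun x : R => complex.Im (cpow x (- s))).
Proof.
under eq_fun do rewrite Im_cpow; apply: measurable_funM.
  by apply: (measurableT_comp (@measurable_expR R)); exact: measurable_Mln.
apply: (measurableT_comp (f := sin)); last exact: measurable_Mln.
by apply: continuous_measurable_fun => ?; exact: continuous_sin.
Qed.

Lemma normcE z : normc z = Num.sqrt (complex.Re z ^+ 2 + complex.Im z ^+ 2).
Proof. by case: z. Qed.

Lemma measurable_Re_clog s :
  measurable_fun setT (fun x : R => complex.Re (clog (1 - cpow x (- s))^-1)).
Proof.
under eq_fun do rewrite Re_clog_geom normcE ReB ImB.
apply: measurable_funN; apply: (measurableT_comp (@measurable_ln R)).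
have msqrt : measurable_fun setT (@Num.sqrt R).
  by apply: continuous_measurable_fun => ?; exact: sqrt_continuous.
apply: (measurableT_comp msqrt).
apply: measurable_funD; apply: measurable_funX; apply: measurable_funB => //.
  exact: measurable_Re_cpow.
exact: measurable_Im_cpow.
Qed.

Lemma normc_cpow_lt1 x s : 0 < complex.Re s -> 1 < x -> normc (cpow x (- s)) < 1.
Proof.
by move=> s0 x1; rewrite normc_cpow expR_lt1 mulNr oppr_lt0 mulr_gt0// ln_gt0.
Qed.

(* The quotient [b / a] with [a > 0] is written [b * expR (- ln a)] to make its
   measurability immediate. *)
Lemma measurable_Im_clog s : 0 < complex.Re s ->
  measurable_fun (`]1, +oo[ : set R) (fun x : R => complex.Im (clog (1 - cpow x (- s))^-1)).
Proof.
move=> s0; apply: (eq_measurable_fun (fun x : R => atan (complex.Im (cpow x (- s)) *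
    expR (- ln (1 - complex.Re (cpow x (- s))))))).
  move=> x; rewrite inE/= in_itv/= andbT => x1.
  have h := normc_cpow_lt1 s0 x1.
  rewrite Im_clog_geom// expRN lnK// posrE; exact: Re_lt_norm.
apply: measurable_funTS; apply: (measurableT_comp (f := atan)).
  by apply: continuous_measurable_fun => ?; exact: continuous_atan.
apply: measurable_funM; first exact: measurable_Im_cpow.
apply: (measurableT_comp (@measurable_expR R)); apply: measurable_funN.
apply: (measurableT_comp (@measurable_ln R)); apply: measurable_funB => //.
exact: measurable_Re_cpow.
Qed.

Lemma cintegral_step c (D : set R) (f : R -> R[i]) l :
  c 0%N = 0%N -> measurable D -> (forall n, c n != 0%N -> D n%:R) ->
  measurable_fun D (fun x => complex.Re (f x)) ->
  measurable_fun D (fun x => complex.Im (f x)) ->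
  cvgn (series (fun n => (c n)%:R * `|complex.Re (f n%:R)|)) ->
  cvgn (series (fun n => (c n)%:R * `|complex.Im (f n%:R)|)) ->
  ccvg (fun N => \sum_(0 <= n < N) (c n)%:R * f n%:R) l ->
  stieltjes_cintegrable (step c) D f /\ stieltjes_cintegral (step c) D f = l.
Proof.
move=> c0 mD cD mr mi rc ic [lr li].
have [ir Ir] := integral_step c0 mD cD mr rc.
have [ii Ii] := integral_step c0 mD cD mi ic.
split; first by split.
have Er : (fun N => complex.Re (\sum_(0 <= n < N) (c n)%:R * f n%:R)) =
    series (fun n => (c n)%:R * complex.Re (f n%:R)).
  by apply/funext => N; rewrite Re_sum; apply: eq_bigr => n _; rewrite Re_natM.
have Ei : (fun N => complex.Im (\sum_(0 <= n < N) (c n)%:R * f n%:R)) =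
    series (fun n => (c n)%:R * complex.Im (f n%:R)).
  by apply/funext => N; rewrite Im_sum; apply: eq_bigr => n _; rewrite Im_natM.
rewrite Er in lr; rewrite Ei in li.
apply: complex_ext => /=.
  exact: (cvg_unique _ Ir lr).
exact: (cvg_unique _ Ii li).
Qed.

(** This supplies the N to which [has_density] is applied. Both Stieltjes integrals become series,
    and the required identity is [cseries_beurling]; [step m] is right-continuous, hence its own
    regularization. *)
Lemma is_calN_step (m : nat -> nat) : m 0%N = 0%N -> m 1%N = 0%N ->
  (forall x, 1 < x -> cvgn (series (dterm m x))) ->
  is_calN (@step R m) (@step R (beurling_coef m)).
Proof.
move=> m0 m1 mc; split.
- move=> x x1; have /eqP tx : Num.truncn x == 0%N.
    by rewrite -leqn0 truncn_le_nat.
  by rewrite /= /step tx big_nat1.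
- by rewrite /= /step truncn1 big_nat_recr//= big_nat1/= add0r.
exists (@step R m); split; first by move=> y _; exact: step_right_continuous.
move=> s s1; have s0 : 0 < complex.Re s by lra.
have [l lc] := logsum_cvg m0 m1 mc s1.
have Nc := cseries_beurling m0 m1 mc s1 lc.
have bc := beurling_coef_cvg m0 m1 mc s1.
have mb : measurable (`[1%R, +oo[%classic : set R) by exact: measurable_itv.
have mo : measurable (`]1%R, +oo[%classic : set R) by exact: measurable_itv.
have dom c (g : R -> R) : cvgn (series (dterm c (complex.Re s))) ->
    (forall n, c n != 0%N -> `|g n%:R| <= 2 * npow (complex.Re s) n) ->
    cvgn (series (fun n => (c n)%:R * `|g n%:R|)).
  move=> cc cg; apply: (@series_le_cvg _ _ (fun n => 2 * dterm c (complex.Re s) n)).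
  - by move=> n; rewrite mulr_ge0.
  - by move=> n; rewrite mulr_ge0// dterm_ge0.
  - move=> n; rewrite /dterm mulrCA; have [->|/cg h] := eqVneq (c n) 0%N.
      by rewrite !mul0r.
    by rewrite ler_wpM2l.
  - exact: (is_cvg_seriesZ cc).
have [iN IN] : stieltjes_cintegrable (@step R (beurling_coef m)) `[1, +oo[ (fun x => cpow x (- s))
    /\ stieltjes_cintegral (@step R (beurling_coef m)) `[1, +oo[ (fun x => cpow x (- s)) = cexp l.
  apply: cintegral_step => //.
  - by move=> [|n] //= _; rewrite in_itv/= andbT ler1n.
  - exact: measurable_funTS (measurable_Re_cpow s).
  - exact: measurable_funTS (measurable_Im_cpow s).
  - apply: (dom _ (fun x => complex.Re (cpow x (- s)))) => // n _; have := ger_Re (dchar s n); rewrite normc_dchar => h.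
    by apply: le_trans h _; rewrite ler_peMl ?npow_ge0// ler1n.
  - apply: (dom _ (fun x => complex.Im (cpow x (- s)))) => // n _; have := ger_Im (dchar s n); rewrite normc_dchar => h.
    by apply: le_trans h _; rewrite ler_peMl ?npow_ge0// ler1n.
have [iF IF] : stieltjes_cintegrable (@step R m) `]1, +oo[ (fun y => clog (1 - cpow y (- s))^-1)
    /\ stieltjes_cintegral (@step R m) `]1, +oo[ (fun y => clog (1 - cpow y (- s))^-1) = l.
  apply: cintegral_step => //.
  - move=> [|[|n]] //=; rewrite ?m0 ?m1// => _.
    by rewrite in_itv/= andbT ltr1n.
  - exact: measurable_funTS (measurable_Re_clog s).
  - exact: measurable_Im_clog.
  - apply: (dom _ (fun x => complex.Re (clog (1 - cpow x (- s))^-1))); first exact: mc.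
    move=> [|[|n]]; rewrite ?m0 ?m1// => _.
    by have [] := @geomlog_le R s n.+2 s1 isT.
  - apply: (dom _ (fun x => complex.Im (clog (1 - cpow x (- s))^-1))); first exact: mc.
    move=> [|[|n]]; rewrite ?m0 ?m1// => _.
    by have [] := @geomlog_le R s n.+2 s1 isT.
by split => //; rewrite IF IN.
Qed.

End CalN.

(** * Comparison of two systems of generalized primes *)

Section Compare.
Variable R : realType.
Implicit Types (q r : nat -> nat) (x : R).

Definition increments q n : nat := (q n - q n.-1)%N.

(** Vanishing at 1 excludes the generator 1, whose Euler factor (1 - 1^-s)^-1 is meaningless. *)
Definition gen_counting q := [/\ q 0%N = 0%N, q 1%N = 0%N & {homo q : m n / (m <= n)%N}].

Lemma sum_increments q n : gen_counting q ->
  \sum_(0 <= k < n.+1) (increments q k)%:R = (q n)%:R :> R.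
Proof.
case=> q0 q1 qh; elim: n => [|n IH]; first by rewrite big_nat1 /increments q0.
by rewrite big_nat_recr//= IH -natrD /increments /= subnKC// qh.
Qed.

Lemma step_increments q x : gen_counting q ->
  step (increments q) x = (q (Num.truncn x))%:R.
Proof. exact: sum_increments. Qed.

Lemma increments0 q : gen_counting q -> increments q 0 = 0%N.
Proof. by case=> q0 _ _; rewrite /increments q0. Qed.

Lemma increments1 q : gen_counting q -> increments q 1 = 0%N.
Proof. by case=> q0 q1 _; rewrite /increments q0 q1. Qed.

Lemma sum_lt0 n : \sum_(0 <= k < n.+1) (0 < k)%N%:R = n%:R :> R.
Proof.
elim: n => [|n IH]; first by rewrite big_nat1.
by rewrite big_nat_recr//= IH natr1.
Qed.

(** The weights C - m(k), for k > 0, have partial sums C n - q(n) >= 0, so Abel summation bounds the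
    series by C times zeta. *)
Lemma increments_cvg q C x : gen_counting q -> (forall n, (q n <= C * n)%N) ->
  1 < x -> cvgn (series (dterm (increments q) x)).
Proof.
move=> qg qC x1; apply: (@bounded_series_cvg _ _ (C%:R * (1 + (x - 1)^-1))) => [n|n].
  exact: dterm_ge0.
apply: le_trans (ler_wpM2l _ (zeta_bounded n x1)); last by [].
rewrite mulr_sumr -subr_ge0 -sumrB.
under eq_bigr do rewrite mulrA -mulrBl.
apply: abel_sum_ge0 => [|[|k]|k|k k0].
- by rewrite increments0// mulr0 subr0.
- by rewrite big_geq.
- by rewrite sumrB -mulr_sumr sum_lt0 sum_increments// subr_ge0 -natrM ler_nat.
- exact: npow_ge0.
- by apply: npow_le => //; lra.
Qed.

Lemma ell_cvg1 k : (1 < k)%N -> ell x k @[x --> (1 : R)^'+] --> ell (1 : R) k.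
Proof.
move=> k1; apply: cvg_at_right_filter; apply: cvgN.
have p1 : npow (1 : R) k < 1 by rewrite npow1 ?invf_lt1 ?ltr1n ?ltr0n// ltnW.
apply: continuous_cvg; first by apply: continuous_ln; rewrite subr_gt0.
apply: cvgB; first exact: cvg_cst.
apply: continuous_cvg; first exact: continuous_expR.
by apply: cvgMl; apply: cvgN; exact: cvg_id.
Qed.

(** The difference is exactly -ln(1 - 1/k^2), because (1 - 1/k) / (1 - 1/(k+1)) = (k-1)(k+1) /
    k^2. *)
Lemma ell_gap k : (1 < k)%N -> (k%:R ^+ 2)^-1 <= ell (1 : R) k - ell 1 k.+1.
Proof.
move=> k1; rewrite /ell !npow1//; last exact: ltnW.
have k0 : 0 < k%:R :> R by rewrite ltr0n ltnW.
have k2 : 1 < k%:R :> R by rewrite ltr1n.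
have ks : 0 < k.+1%:R :> R by rewrite ltr0n.
have kE : k.+1%:R = k%:R + 1 :> R by rewrite natr1.
have h1 : 0 < 1 - k%:R^-1 :> R by rewrite subr_gt0 invf_lt1.
have h2 : 0 < 1 - k.+1%:R^-1 :> R by rewrite subr_gt0 invf_lt1// kE ltrDr.
rewrite opprK addrC -ln_div ?posrE// -lerN2 -lnV ?posrE ?divr_gt0// invf_div.
have -> : (1 - k%:R^-1) / (1 - k.+1%:R^-1) = 1 + (- (k%:R ^+ 2)^-1) :> R.
  by rewrite kE; field; rewrite !gt_eqF//; lra.
by apply: le_ln1Dx; rewrite ltrN2 invf_lt1 ?exprn_gt0// expr_gt1// ltW.
Qed.

Lemma lim_ler_scale (u v : R^nat) C : cvgn u -> cvgn v ->
  (forall n, u n <= C * v n) -> limn u <= C * limn v.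
Proof.
move=> uc vc uv; apply: (ler_cvg_to uc (cvgMl_tmp vc)); exact: nearW.
Qed.

Section Two.
Variables (q r : nat -> nat) (Cq Cr : nat) (C : R).
Hypotheses (qg : gen_counting q) (rg : gen_counting r).
Hypotheses (qC : forall n, (q n <= Cq * n)%N) (rC : forall n, (r n <= Cr * n)%N).
Hypothesis rq : forall n, (r n <= q n)%N.
Hypothesis C0 : 0 < C.
Hypothesis AC : forall n, \sum_(0 <= k < n) (beurling_coef (increments q) k)%:R <=
  C * \sum_(0 <= k < n) (beurling_coef (increments r) k)%:R.

Local Notation mq := (increments q).
Local Notation mr := (increments r).

Let q0 := increments0 qg.
Let q1 := increments1 qg.
Let r0 := increments0 rg.
Let r1 := increments1 rg.
Let qc x (x1 : 1 < x) := increments_cvg qg qC x1.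
Let rc x (x1 : 1 < x) := increments_cvg rg rC x1.

Lemma dirichlet_compare x : 1 < x ->
  limn (series (lterm mq x)) - limn (series (lterm mr x)) <= ln C.
Proof.
move=> x1; set lq := limn _; set lr := limn _.
have h : expR lq <= C * expR lr.
  rewrite -(beurling_lim q0 q1 qc x1) -(beurling_lim r0 r1 rc x1).
  apply: lim_ler_scale; [exact: beurling_coef_cvg|exact: beurling_coef_cvg|].
  move=> n; rewrite /series/= mulr_sumr -subr_ge0 -sumrB.
  under eq_bigr do rewrite /dterm mulrA -mulrBl.
  apply: abel_sum_ge0 => [|k|k|k k0].
  - by rewrite !beurling_coef0 mulr0 subr0.
  - by rewrite sumrB -mulr_sumr subr_ge0 AC.
  - exact: npow_ge0.
  - by apply: npow_le => //; lra.
have e0 : 0 < expR (lq - lr) by exact: expR_gt0.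
rewrite -(expRK (lq - lr)) ler_ln ?posrE//.
by rewrite expRB ler_pdivrMr ?expR_gt0.
Qed.

(* Abel summation turns the sum into one with nonnegative terms, so that its
   truncations inherit the bound; x -> 1 then only involves finite sums. *)
Lemma partial_compare x X : 1 < x ->
  \sum_(0 <= k < X) ((q k)%:R - (r k)%:R) * (ell x k - ell x k.+1) <= ln C.
Proof.
move=> x1; apply: le_trans (dirichlet_compare x1).
have c : series (lterm mq x) n - series (lterm mr x) n @[n --> \oo] -->
    limn (series (lterm mq x)) - limn (series (lterm mr x)).
  by apply: cvgB; [exact: (lterm_cvg q0 q1 qc x1)|exact: (lterm_cvg r0 r1 rc x1)].
apply: (cvgr_to_ge c); exists X.+1 => // -[//|n] /= Xn.
rewrite [leRHS](_ : _ = \sum_(0 <= k < n.+1) ((mq k)%:R - (mr k)%:R) * ell x k); last first.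
  by rewrite /series/= -[LHS]sumrB; apply: eq_bigr => k _; rewrite mulrBl.
have x0 : 0 <= x by lra.
rewrite abel_sum sumrB !sum_increments//.
under [X in _ <= X + _]eq_bigr do rewrite sumrB !sum_increments//.
(* The boundary term (q n - r n) [ell x n] is nonnegative and is dropped. *)
apply: ler_wpDr.
  by rewrite mulr_ge0 ?ell_ge0// subr_ge0 ler_nat.
rewrite [leRHS](big_cat_nat (n := X))//= lerDl big_nat sumr_ge0// => k /andP[_ _].
(* At k = 1 the default value [ell x 1 = 0] breaks monotonicity of [ell]; the term vanishes because
   q 1 = r 1 = 0. *)
have [k1|k1] := leqP k 1.
  case: qg => qz qo _; case: rg => rz ro _.
  by case: k k1 => [|[|]]// _; rewrite ?qz ?qo ?rz ?ro subrr mul0r.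
have p1 : 0 < 1 - npow x k.
  by rewrite subr_gt0; apply: le_lt_trans (npow_le_half x1 k1) _; lra.
have p2 : npow x k.+1 <= npow x k by rewrite npow_le// ltnW.
rewrite mulr_ge0 ?subr_ge0 ?ler_nat// lerN2 ler_ln ?posrE//; lra.
Qed.

Lemma sum_sq_compare X :
  \sum_(0 <= k < X) ((q k)%:R - (r k)%:R) / k%:R ^+ 2 <= ln C.
Proof.
have low k : (k <= 1)%N -> (q k)%:R - (r k)%:R = 0 :> R.
  case: qg => qz qo _; case: rg => rz ro _.
  by case: k => [|[|]]// _; rewrite ?qz ?qo ?rz ?ro subrr.
apply: (@le_trans _ _ (\sum_(0 <= k < X) ((q k)%:R - (r k)%:R) * (ell 1 k - ell 1 k.+1))).
  apply: ler_sum => k _; have [k1|k1] := leqP k 1; first by rewrite low// !mul0r.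
  by rewrite ler_wpM2l ?ell_gap// subr_ge0 ler_nat.
have c : \sum_(0 <= k < X) ((q k)%:R - (r k)%:R) * (ell x k - ell x k.+1) @[x --> (1:R)^'+] -->
    \sum_(0 <= k < X) ((q k)%:R - (r k)%:R) * (ell 1 k - ell 1 k.+1).
  apply: cvg_big => [|k _]; first exact: add_continuous.
  have [k1|k1] := leqP k 1.
    by rewrite low// mul0r; under eq_fun do rewrite mul0r; exact: cvg_cst.
  by apply: cvgMl_tmp; apply: cvgB; apply: ell_cvg1 => //; exact: ltnW.
apply: (cvgr_to_le c); near=> x; apply: partial_compare.
by near: x; exact: nbhs_right_gt.
Unshelve. all: by end_near. Qed.

End Two.

(** Abel summation needs bounds for every n, while the density gives them only from some K on, with
    factors c/2 and c + 1. For 1 <= n <= K the counting function lies between its value 1 at n = 1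
    and its value at K, which explains the two maxima. *)
Lemma density_bounds (a : nat -> nat) (c : R) : a 0%N = 0%N -> a 1%N = 1%N ->
  c != 0 -> step a x / x @[x --> +oo] --> c ->
  (exists2 C : R, 0 < C & forall n, \sum_(0 <= k < n.+1) (a k)%:R <= C * n%:R) /\
  (exists2 C : R, 0 < C & forall n, n%:R <= C * \sum_(0 <= k < n.+1) (a k)%:R).
Proof.
move=> a0 a1 c0 Nc.
have cge : 0 <= c.
  apply: (cvgr_to_ge Nc); near=> x; rewrite divr_ge0//; exact: sumr_ge0.
have cgt : 0 < c by rewrite lt_neqAle eq_sym c0.
have : \forall x \near +oo, c / 2 <= step a x / x <= c + 1.
  near=> x; apply/andP; split; near: x.
    by apply: (cvgr_ge _ Nc); rewrite ltr_pdivrMr// ltr_pMr// ltr1n.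
  by apply: (cvgr_le _ Nc); rewrite ltrDl.
case=> M [_ hM].
pose K := (Num.truncn (Num.max M 1)).+1.
have MK : M < K%:R by apply: le_lt_trans (truncnS_gt _); rewrite le_max lexx.
have h n : (K <= n)%N -> c / 2 * n%:R <= step a n%:R <= (c + 1) * n%:R.
  move=> Kn; have n0 : 0 < n%:R :> R by rewrite ltr0n (leq_trans _ Kn).
  have := hM n%:R; rewrite ler_pdivlMr// ler_pdivrMr//; apply.
  by apply: lt_le_trans MK _; rewrite ler_nat.
have mono m n : (m <= n)%N -> step a (m%:R : R) <= step a n%:R.
  by move=> mn; apply: step_nondecreasing; rewrite ler_nat.
have s0 : step a (0%:R : R) = 0 by rewrite step_nat big_nat1 a0.
have s1 : step a (1%:R : R) = 1 by rewrite step_nat big_nat_recr//= big_nat1 a0 a1 add0r.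
have sK : 1 <= step a (K%:R : R) by have := mono 1%N K isT; rewrite s1.
split.
  exists (Num.max (c + 1) (step a K%:R)).
    by rewrite lt_max; apply/orP; left; lra.
  move=> [|n]; first by rewrite big_nat1 a0 mulr0.
  rewrite -step_nat; have [Kn|/ltnW nK] := leqP K n.+1.
    have /andP[_] := h _ Kn; move/le_trans; apply.
    by rewrite ler_wpM2r// le_max lexx.
  apply: le_trans (mono _ _ nK) _.
  apply: (@le_trans _ _ (Num.max (c + 1) (step a K%:R))); first by rewrite le_max lexx orbT.
  by rewrite ler_peMr ?ler1n// le_max; apply/orP; left; lra.
exists (Num.max (c / 2)^-1 K%:R).
  by rewrite lt_max invr_gt0 divr_gt0.
move=> [|n]; first by rewrite big_nat1 a0 mulr0.
rewrite -step_nat; have [Kn|/ltnW nK] := leqP K n.+1.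
  have /andP[h1 _] := h _ Kn.
  apply: (@le_trans _ _ ((c / 2)^-1 * step a n.+1%:R)).
    by rewrite ler_pdivlMl ?divr_gt0.
  rewrite ler_wpM2r ?le_max ?lexx//; exact: sumr_ge0.
have n1 : 1 <= step a (n.+1%:R : R) by have := mono 1%N n.+1 isT; rewrite s1.
apply: (@le_trans _ _ K%:R); first by rewrite ler_nat.
apply: (@le_trans _ _ (Num.max (c / 2)^-1 K%:R)); first by rewrite le_max lexx orbT.
by rewrite ler_peMr// le_max ler0n orbT.
Unshelve. all: by end_near. Qed.

End Compare.

(** * The two roundings of P *)

Section Rounding.
Variable R : realType.
Implicit Types (P : R -> R) (q : nat -> nat) (x y : R).

Lemma primepiE y : primepi y = (pin (Num.truncn y))%:R.
Proof. by []. Qed.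

(* The value 0 for [n <= 1] avoids [P 1], about which nothing is known. *)
Definition round_above P n : nat :=
  if (n <= 1)%N then 0%N else maxn (Num.truncn (P n%:R)) (pin n).

(* Since [P y] may increase up to [P n.+1] for y in [n, n+1[, rounding towards
   pi from below has to use [P n.+1]. *)
Definition round_below P n : nat := minn (Num.truncn (P n.+1%:R)).+1 (pin n).

Lemma pin_gen : gen_counting pin.
Proof. by split; [exact: pin0|exact: pin1|exact: pin_homo]. Qed.

Lemma round_above_ge P n : (pin n <= round_above P n)%N.
Proof.
rewrite /round_above; case: ifP => n1; last exact: leq_maxr.
by case: n n1 => [|[|]]//; rewrite ?pin0 ?pin1.
Qed.

Lemma round_below_le P n : (round_below P n <= pin n)%N.
Proof. exact: geq_minr. Qed.

Section Admissible.
Variable P : R -> R.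
Hypothesis Padm : admissible P.

Let P0 y : 1 < y -> 0 <= P y. Proof. by case: Padm => -[+ _] _; apply. Qed.
Let Ph x y : 1 < x -> x <= y -> P x <= P y.
Proof. by case: Padm => -[_ +] _; apply. Qed.

Lemma round_above_gen : gen_counting (round_above P).
Proof.
split=> // m n mn; rewrite /round_above; case: ifPn => // m1.
have n1 : ~~ (n <= 1)%N by lia.
rewrite (negbTE n1) geq_max !leq_max (pin_homo mn) orbT andbT.
by rewrite le_truncn// Ph ?ltr1n ?ler_nat// ltnNge.
Qed.

Lemma round_below_gen : gen_counting (round_below P).
Proof.
split; rewrite /round_below ?pin0 ?pin1 ?minn0// => m n mn.
have [->|m0] := posnP m; first by rewrite pin0 minn0.
rewrite leq_min !geq_min (pin_homo mn) orbT andbT ltnS le_truncn//.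
by rewrite Ph ?ltr1n ?ler_nat.
Qed.

Definition Pabove : R -> R := step (increments (round_above P)).
Definition Pbelow : R -> R := step (increments (round_below P)).

Lemma PaboveE y : Pabove y = (round_above P (Num.truncn y))%:R.
Proof. exact/step_increments/round_above_gen. Qed.

Lemma PbelowE y : Pbelow y = (round_below P (Num.truncn y))%:R.
Proof. exact/step_increments/round_below_gen. Qed.

(** On [n, n+1[ the function pi is constant and P is at least P n, so the rounded value is either pi
    itself or lies between pi and P. *)
Lemma rule2_above : rule2 P Pabove.
Proof.
move=> y y1; rewrite PaboveE primepiE; set n := Num.truncn y.
have y0 : 0 <= y by lra.
have /andP[ny yn] := truncn_itv y0.
rewrite /round_above; case: ifPn => n1.
  by case: n n1 ny yn => [|[|]]// *; rewrite ?pin0 ?pin1 subrr normr0.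
have n1R : 1 < n%:R :> R by rewrite ltr1n ltnNge.
have Py : (Num.truncn (P n%:R))%:R <= P y.
  by apply: le_trans (Ph n1R ny); rewrite truncn_le P0.
have [h|h] := leqP (pin n) (Num.truncn (P n%:R)).
  have h' : (pin n)%:R <= (Num.truncn (P n%:R))%:R :> R by rewrite ler_nat.
  by rewrite !ger0_norm ?lerD2r// subr_ge0// (le_trans h').
by rewrite subrr normr0.
Qed.

Lemma rule2_below : rule2 P Pbelow.
Proof.
move=> y y1; rewrite PbelowE primepiE; set n := Num.truncn y.
have yn : y < n.+1%:R := truncnS_gt y.
(* The successor in [round_below] puts the rounded value above P on all of [n, n+1[; where it is
   below pi, it lies between P and pi. *)
have Py : P y <= (Num.truncn (P n.+1%:R)).+1%:R.
  by apply: le_trans (Ph y1 (ltW yn)) _; rewrite ltW// truncnS_gt.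
rewrite /round_below; have [h|h] := leqP (pin n) (Num.truncn (P n.+1%:R)).+1.
  by rewrite subrr normr0.
have h' : (Num.truncn (P n.+1%:R)).+1%:R <= (pin n)%:R :> R by rewrite ler_nat ltnW.
rewrite !ler0_norm ?subr_le0// ?(le_trans Py)//.
by rewrite lerN2 lerD2r.
Qed.

Lemma primepi_sublinear : primepi y / y @[y --> +oo] --> (0 : R).
Proof.
apply/cvgr0Pnorm_le => e e0.
(* 5 = 4 + 1: the slope 4 of [pin_sublinear], and 1 for its additive constant, which is at most y
   eventually. *)
pose k := (Num.truncn (5 / e)).+1.
have ke : 5 / e < k%:R := truncnS_gt _.
have k0 : 0 < k%:R :> R by rewrite ltr0n.
have [C hC] := pin_sublinear k.
near=> y.
have y1 : 1 <= y by near: y; exact: nbhs_pinfty_ge.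
have yC : C%:R <= y by near: y; exact: nbhs_pinfty_ge.
have y0 : 0 < y by lra.
rewrite primepiE ger0_norm ?divr_ge0 ?(ltW y0)// ler_pdivrMr//.
have ty : (Num.truncn y)%:R <= y by rewrite truncn_le ltW.
have := hC (Num.truncn y); rewrite -(ler_nat R) natrD !natrM => h.
have h5 : k%:R * (pin (Num.truncn y))%:R <= 5 * y by lra.
rewrite ltr_pdivrMr// in ke.
rewrite -(ler_pM2l k0); apply: le_trans h5 _.
by rewrite mulrA ler_wpM2r ?(ltW y0)// ltW.
Unshelve. all: by end_near. Qed.

Lemma step_nonneg_nondecreasing m : nonneg_nondecreasing (step m : R -> R).
Proof.
split=> [y _|x y _ xy]; first exact: sumr_ge0.
exact: step_nondecreasing.
Qed.

Lemma sublinear_le Q : (forall y, 1 < y -> 0 <= Q y <= P y + primepi y) ->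
  Q y / y @[y --> +oo] --> 0.
Proof.
move=> QP.
have h : (P y / y + primepi y / y) @[y --> +oo] --> (0 : R).
  rewrite -(addr0 0); apply: cvgD; last exact: primepi_sublinear.
  by case: Padm.
apply: (@squeeze_cvgr _ _ _ _ (cst 0) (fun y => P y / y + primepi y / y) _ _ _ (cvg_cst _) h).
near=> y; have y1 : 1 < y by near: y; exact: nbhs_pinfty_gt.
have y0 : 0 < y by lra.
have /andP[h1 h2] := QP y y1.
by rewrite divr_ge0 ?(ltW y0)//= -mulrDl ler_pM2r ?invr_gt0.
Unshelve. all: by end_near. Qed.

Lemma admissible_above : admissible Pabove.
Proof.
split; first exact: step_nonneg_nondecreasing.
apply: sublinear_le => y y1; rewrite PaboveE ler0n/= primepiE.
set n := Num.truncn y; have Py := P0 y1.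
have ny : n%:R <= y by rewrite truncn_le; lra.
rewrite /round_above; case: ifPn => n1; first by rewrite addr_ge0.
have n1R : 1 < n%:R :> R by rewrite ltr1n ltnNge.
rewrite /maxn; case: ifP => _; first by rewrite lerDr.
apply: ler_wpDr => //; apply: le_trans (Ph n1R ny).
by rewrite truncn_le P0.
Qed.

Lemma admissible_below : admissible Pbelow.
Proof.
split; first exact: step_nonneg_nondecreasing.
apply: sublinear_le => y y1; rewrite PbelowE ler0n/= primepiE.
by apply: ler_wpDl; rewrite ?P0// ler_nat round_below_le.
Qed.

Lemma round_above_linear : exists C, forall n, (round_above P n <= C * n)%N.
Proof.
have [_ /cvgr0Pnorm_le/(_ 1 ltr01)[M [_ hM]]] := admissible_above.
pose K := (Num.truncn M).+1.
(* Beyond K the rounding is at most n; up to K it is at most its value at K, by monotonicity. *)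
exists (round_above P K).+1 => -[|n]; first by rewrite muln0.
have [nK|Kn] := leqP n.+1 K.
  apply: (@leq_trans (round_above P K)); last by rewrite mulSn mulnS; lia.
  by case: round_above_gen => _ _; apply.
apply: (@leq_trans n.+1); last by rewrite leq_pmull.
have MK : M < n.+1%:R by apply: lt_trans (truncnS_gt _) _; rewrite ltr_nat.
have := hM _ MK; rewrite PaboveE natrK ger0_norm ?divr_ge0//.
by rewrite ler_pdivrMr// mul1r ler_nat.
Qed.

Lemma density_sums : has_density Pabove -> has_density Pbelow ->
  exists C : R, forall X,
    \sum_(0 <= k < X) ((round_above P k)%:R - (pin k)%:R) / k%:R ^+ 2 <= C /\
    \sum_(0 <= k < X) ((pin k)%:R - (round_below P k)%:R) / k%:R ^+ 2 <= C.
Proof.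
move=> dA dB; have [Ca hCa] := round_above_linear.
have pin1n n : (pin n <= 1 * n)%N by rewrite mul1n pin_le.
have rb1 n : (round_below P n <= 1 * n)%N.
  by rewrite mul1n (leq_trans (round_below_le P n))// pin_le.
have pincoef n : \sum_(0 <= k < n.+1) (beurling_coef (increments pin) k)%:R = n%:R :> R.
  have -> : increments pin = (fun k => prime k : nat).
    apply/funext => -[|i]; first by rewrite /increments subnn.
    by rewrite /increments pinS addKn.
  by rewrite -sum_lt0; apply: eq_bigr => -[|k] _ //; rewrite beurling_coef_prime.
have aA := is_calN_step (increments0 round_above_gen) (increments1 round_above_gen)
  (fun x (x1 : 1 < x :> R) => increments_cvg round_above_gen hCa x1).
have aB := is_calN_step (increments0 round_below_gen) (increments1 round_below_gen)
  (fun x (x1 : 1 < x :> R) => increments_cvg round_below_gen rb1 x1).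
have [ca ca0 cA] := dA _ aA; have [cb cb0 cB] := dB _ aB.
(* Each rounding needs one bound only: the upper one gives D_q <= C1 zeta, the lower one zeta <= C2
   D_q. *)
have [[C1 C10 h1] _] := density_bounds (beurling_coef0 _) (beurling_coef1 _) ca0 cA.
have [_ [C2 C20 h2]] := density_bounds (beurling_coef0 _) (beurling_coef1 _) cb0 cB.
exists (Num.max (ln C1) (ln C2)) => X; rewrite !le_max; split; apply/orP.
  left; apply: (sum_sq_compare round_above_gen pin_gen hCa pin1n (round_above_ge P) C10).
  by move=> [|n]; [rewrite !big_geq// mulr0|rewrite pincoef].
right; apply: (sum_sq_compare pin_gen round_below_gen pin1n rb1 (round_below_le P) C20).
by move=> [|n]; [rewrite !big_geq// mulr0|rewrite pincoef].
Qed.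

(** On [n, n+1[, P is at most P(n+1), which [round_above] controls at n + 1, and at least P n, which
    [round_below] sees at n - 1. The constant leaves room for a rounding error of at most 1 and a
    jump of pi of at most 1 between neighbouring integers. *)
Definition gap n : R := ((round_above P n.+1)%:R - (pin n.+1)%:R) +
  ((pin n.-1)%:R - (round_below P n.-1)%:R) + 3.

Lemma gap_ge y : 1 < y -> `|P y - primepi y| <= gap (Num.truncn y).
Proof.
move=> y1; rewrite primepiE; set n := Num.truncn y.
have n0 : (0 < n)%N by rewrite truncn_gt0 ltW.
have yn : y < n.+1%:R := truncnS_gt y.
have ny : n%:R <= y by rewrite truncn_le; lra.
have a1 : (pin n.+1)%:R <= (round_above P n.+1)%:R :> R by rewrite ler_nat round_above_ge.
have b1 : (round_below P n.-1)%:R <= (pin n.-1)%:R :> R by rewrite ler_nat round_below_le.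
have s1 : (pin n.+1)%:R <= (pin n)%:R + 1 :> R.
  by rewrite pinS natrD lerD2l; case: prime.
have s2 : (pin n)%:R <= (pin n.-1)%:R + 1 :> R.
  by rewrite -(prednK n0) pinS natrD lerD2l; case: prime.
rewrite /gap ler_norml; apply/andP; split; last first.
  have : P y <= (round_above P n.+1)%:R + 1.
    apply: le_trans (Ph y1 (ltW yn)) _; apply: le_trans (ltW (truncnS_gt _)) _.
    rewrite /round_above ltnS leqNgt n0/=; set t := Num.truncn _.
    by rewrite -[t.+1%:R]natr1 lerD2r ler_nat leq_maxl.
  lra.
(* For n = 1 the argument through P n would involve the uncontrolled value P 1; there pi = 0 and P
   >= 0 suffice. *)
have [n1|n1] := leqP n 1.
  have nE : n = 1%N by apply/eqP; rewrite eqn_leq n1.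
  have := P0 y1; rewrite nE pin1 in a1 b1 s1 s2 * => ?; lra.
have n1R : 1 < n%:R :> R by rewrite ltr1n.
have : (round_below P n.-1)%:R <= P n%:R + 1.
  apply: (@le_trans _ _ (Num.truncn (P n%:R)).+1%:R).
    by rewrite ler_nat /round_below prednK// geq_minl.
  by rewrite -natr1 lerD2r truncn_le P0.
have := Ph n1R ny; lra.
Qed.

Lemma gap_ge0 n : 0 <= gap n.
Proof.
have := round_above_ge P n.+1; have := round_below_le P n.-1.
rewrite -!(ler_nat R) /gap; lra.
Qed.

Lemma gap_sum C : (forall X,
    \sum_(0 <= k < X) ((round_above P k)%:R - (pin k)%:R) / k%:R ^+ 2 <= C /\
    \sum_(0 <= k < X) ((pin k)%:R - (round_below P k)%:R) / k%:R ^+ 2 <= C) ->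
  forall X, \sum_(0 <= k < X) gap k.+1 / k.+1%:R ^+ 2 <= 5 * C + 6.
Proof.
move=> hC X.
pose u k : R := ((round_above P k)%:R - (pin k)%:R) / k%:R ^+ 2.
pose v k : R := ((pin k)%:R - (round_below P k)%:R) / k%:R ^+ 2.
have u0 k : 0 <= u k by rewrite divr_ge0 ?exprn_ge0// subr_ge0 ler_nat round_above_ge.
have v0 k : 0 <= v k by rewrite divr_ge0 ?exprn_ge0// subr_ge0 ler_nat round_below_le.
have vz : v 0%N = 0 by rewrite /v expr0n invr0 mulr0.
(* The index shifts cost (k+2)^2 <= 4 (k+1)^2 above and nothing below. Summed, this gives 4C + C + 3
   * 2, since zeta(2) <= 2 by [zeta_bounded]. *)
have b k : gap k.+1 / k.+1%:R ^+ 2 <= 4 * u k.+2 + v k + 3 * npow 2 k.+1.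
  have k1 : 0 < k.+1%:R :> R by rewrite ltr0n.
  rewrite /gap mulrDl mulrDl; apply: lerD; [apply: lerD|].
  - rewrite /u mulrCA ler_wpM2l ?subr_ge0 ?ler_nat ?round_above_ge//.
    rewrite -[leLHS]mul1r -ler_pdivlMr ?invr_gt0 ?exprn_gt0// invrK.
    rewrite mulrAC ler_pdivlMr ?exprn_gt0 ?ltr0n// mul1r.
    rewrite -natrX -natrX -natrM ler_nat; nia.
  - rewrite /= /v; case: k k1 => [|k] k1.
      by rewrite pin0 (eqP (_ : round_below P 0 == 0)%N) ?subrr ?mul0r// -leqn0 (leq_trans (round_below_le P 0))// pin0.
    rewrite ler_wpM2l ?subr_ge0 ?ler_nat ?round_below_le//.
    by rewrite lef_pV2 ?posrE ?exprn_gt0 ?ltr0n// ler_pXn2r ?nnegrE// ler_nat.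
  - rewrite ler_wpM2l// (_ : 2 = 1 + 1)// npowD !npow1// -invfM -expr2.
    by rewrite lexx.
apply: (le_trans (ler_sum _ (fun k _ => b k))).
rewrite !big_split/= -!mulr_sumr.
have [_ hv] := hC X.
have [hu _] := hC X.+2.
have z2 : 1 < 2 :> R by rewrite ltr1n.
have := zeta_bounded X.+1 z2.
rewrite big_nat_recl//= mul0r add0r (_ : 2 - 1 = 1) ?invr1; last by lra.
under eq_bigr do rewrite mul1r.
move=> hz.
have hu' : \sum_(0 <= k < X) u k.+2 <= C.
  apply: le_trans hu; rewrite [leRHS]big_nat_recl//= [leRHS](addrC) big_nat_recl//=.
  by have := u0 0%N; have := u0 1%N; rewrite /u; lra.
move: hu' hz hv; rewrite -/(v _); lra.
Qed.

Lemma measurable_gap_integrand : measurable_fun (`]1%R, +oo[%classic : set R)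
  (fun y => (`|P y - primepi y| / y ^+ 2)%:E).
Proof.
apply/measurable_EFinP.
(* Replacing P by 0 up to 1 makes it monotone on the whole line, hence measurable. *)
pose Pt y := if y <= 1 then 0 else P y.
have mo : measurable (`]1%R, +oo[%classic : set R) by exact: measurable_itv.
apply: (eq_measurable_fun (fun y => `|Pt y - primepi y| * expR (- 2 * ln y))).
  move=> y; rewrite inE/= in_itv/= andbT => y1.
  rewrite /Pt leNgt y1/=; congr (_ * _).
  have y0 : 0 < y by lra.
  by rewrite mulNr expRN expRM_natl lnK.
apply: measurable_funM.
  apply: measurableT_comp => //; apply: measurable_funB.
    apply: nondecreasing_measurable => // x y xy; rewrite /Pt.
    have [x1|x1] := leP x 1; have [y1|y1] := leP y 1 => //.
    - exact: P0.
    - by exfalso; lra.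
    - exact: Ph.
  apply: nondecreasing_measurable => // x y xy.
  by rewrite !primepiE ler_nat pin_homo// le_truncn.
apply: (measurableT_comp (@measurable_expR R)).
by apply: measurable_funTS; exact: measurable_Mln.
Qed.

Lemma close_of_density : has_density Pabove -> has_density Pbelow ->
  close_to_primepi P.
Proof.
move=> dA dB; have [C hC] := density_sums dA dB.
(* The intersection matters only for n = 0, where it removes the point 1. *)
pose F n : set R := `]1%R, +oo[%classic `&` `[n.+1%:R, n.+2%:R[%classic.
have FE : `]1%R, +oo[%classic = \bigcup_n F n.
  apply/seteqP; split => [y|y [n _ []]//].
  rewrite /= in_itv/= andbT => y1.
  exists (Num.truncn y).-1 => //; split; rewrite /= in_itv/= ?y1//.
  rewrite prednK ?truncn_gt0 ?(ltW y1)// truncnS_gt andbT truncn_le; lra.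
have mF n : measurable (F n) by apply: measurableI; exact: measurable_itv.
have tF : trivIset setT F.
  apply/trivIsetP => i j _ _ ij; apply/seteqP; split => // y [[_ +] [_ +]].
  rewrite /= !in_itv/= => /andP[i1 i2] /andP[j1 j2].
  have h1 : i.+1%:R < j.+2%:R :> R by exact: le_lt_trans j2.
  have h2 : j.+1%:R < i.+2%:R :> R by exact: le_lt_trans i2.
  move: h1 h2; rewrite !ltr_nat => h1 h2; move/eqP: ij; lia.
have mf := measurable_gap_integrand.
rewrite /close_to_primepi FE ge0_integral_bigcup//; last 2 first.
- by rewrite -FE.
- by move=> y _; rewrite lee_fin divr_ge0// sqr_ge0.
apply: (@le_lt_trans _ _ (5 * C + 6)%:E); last by rewrite ltry.
apply: lime_le; first by apply: is_cvg_nneseries => n _ _; apply: integral_ge0 => y _; rewrite lee_fin divr_ge0// sqr_ge0.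
apply: nearW => X.
apply: (@le_trans _ _ (\sum_(0 <= n < X) (gap n.+1 / n.+1%:R ^+ 2)%:E)%E); last first.
  by rewrite sumEFin lee_fin gap_sum.
apply: lee_sum => n _.
have n1 : 0 < n.+1%:R :> R by rewrite ltr0n.
have b y : F n y -> `|P y - primepi y| / y ^+ 2 <= gap n.+1 / n.+1%:R ^+ 2.
  move=> []; rewrite /= !in_itv/= andbT => y1 yn.
  have yE : Num.truncn y = n.+1 by exact: truncn_def.
  have /andP[yn1 _] := yn.
  have y0 : 0 < y by lra.
  apply: ler_pM => //; first by rewrite invr_ge0 sqr_ge0.
    by rewrite -yE gap_ge.
  by rewrite lef_pV2 ?posrE ?exprn_gt0// ler_pXn2r// nnegrE ltW.
have mFf : measurable_fun (F n) (fun y => (`|P y - primepi y| / y ^+ 2)%:E).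
  by apply: measurable_funS mf => //; exact: subIsetl.
have K0 : 0 <= gap n.+1 / n.+1%:R ^+ 2 by rewrite divr_ge0 ?gap_ge0// sqr_ge0.
apply: (@le_trans _ _ (\int[lebesgue_measure]_(y in F n) (gap n.+1 / n.+1%:R ^+ 2)%:E)%E).
  apply: ge0_le_integral.
  - exact: mF.
  - by move=> y _; rewrite lee_fin divr_ge0// sqr_ge0.
  - exact: mFf.
  - exact: measurable_cst.
  - by move=> y /b; rewrite lee_fin.
rewrite integral_cst//; last exact: mF.
apply: (@le_trans _ _ ((gap n.+1 / n.+1%:R ^+ 2)%:E * 1)%E); last by rewrite mule1.
apply: lee_wpmul2l; first by rewrite lee_fin.
apply: (@le_trans _ _ (lebesgue_measure (`[n.+1%:R, n.+2%:R[%classic : set R))).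
  apply: le_measure; rewrite ?inE//; last exact: subIsetr.
  exact: mF.
rewrite lebesgue_measure_itv/= lte_fin ltr_nat ltnSn -EFinB lee_fin.
by rewrite -[n.+2%:R]natr1 addrAC subrr add0r.
Qed.


End Admissible.
End Rounding.

Theorem theorem3 (R : realType) :
  (forall P : R -> R, admissible P ->
     (forall P' : R -> R, obtained P P' -> has_density P') ->
     close_to_primepi P)
  /\
  (forall C : (R -> R) -> Prop,
     preserved C ->
     (forall Q : R -> R, admissible Q -> C Q -> has_density Q) ->
     forall P : R -> R, admissible P -> C P -> close_to_primepi P).
Proof.
split=> [P Padm dP|C Cp Cd P Padm CP].
  apply: close_of_density => //; apply: dP.
    apply: obtained_rule2 (obtained_refl P) _ (rule2_above Padm).
    by case: (admissible_above Padm).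
  apply: obtained_rule2 (obtained_refl P) _ (rule2_below Padm).
  by case: (admissible_below Padm).
(* [preserved] transfers C only between admissible functions, so the roundings themselves must be
   o(y). *)
have aA := admissible_above Padm; have aB := admissible_below Padm.
apply: close_of_density => //; apply: Cd => //.
  by apply: Cp CP => //; right; exact: rule2_above.
by apply: Cp CP => //; right; exact: rule2_below.
Qed.
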